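(* There exist universal constants $c_0>0$ and $C>0$ such that the following holds. Let $p<N$ be positive integers and $\sigma>0$. Let $m\ge 1$ be an integer and $\mu$ a number satisfying $\mu<\frac{1}{2m-1}$ and the following inequalities, where $\tilde p=p-m$, $\tilde N=N-m$, and $L=\mu_{\min}(\tilde p,\tilde N)$ is the smallest possible coherence of a $\tilde p\times\tilde N$ dictionary: $$m\le\min\{N^{\beta},p\}\quad\text{where } 0<\beta<1,$$ $$m\le\frac{3-L-\sqrt{8-8L}}{L},$$ and $$\frac{(1+L(m-1))\left(1-\sqrt{1-\frac{4L(2m-1-Lm)}{(1+L(m-1))^2}}\right)}{2(2m-1-Lm)}\ \le\ \mu\ \le\ \frac{(1+L(m-1))\left(1+\sqrt{1-\frac{4L(2m-1-Lm)}{(1+L(m-1))^2}}\right)}{2(2m-1-Lm)}.$$ Let $$\rho=\sqrt{\frac{1-(m-1)\mu}{m}},\qquad \tilde\mu=\frac{\mu^2}{\rho^2}=\frac{\mu^2 m}{1-(m-1)\mu},$$ and assume that the quantity $$R=\sqrt{2(1-\mu)(1-\tilde\mu)\log\tilde N}-\sqrt{2\beta(1-\rho^2)\log N}-c_0\sqrt{(1-\tilde\mu)\log\log\tilde N}-\left(\rho+\sqrt{\tilde\mu}\right)\sqrt{2\log\log N}$$ is positive. Then there exist a dictionary $\boldsymbol{\Phi}\in\mathbb{R}^{p\times N}$ with unit-norm columns and coherence $\mu$, and a corresponding $m$-sparse vector $\mathbf{x}\in\mathbb{R}^N$ satisfying $$x_{\min}=\frac{\sigma}{1-(2m-1)\mu}\cdot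 R,$$ such that with probability at least $$P_0=1-6e^{-C\sqrt{\log\log\tilde N\,\min\{\mu^{-1},\,\log\tilde N\}}}-\left(\log N\sqrt{\pi\log\log N}\right)^{-1}-\left(\sqrt{\pi\beta\log N}\right)^{-1},$$ OMP (with $m$ iterations) fails to recover the support of $\mathbf{x}$ from $\mathbf{s}=\boldsymbol{\Phi}\mathbf{x}+\sigma\boldsymbol{\xi}$, where $\boldsymbol{\xi}\sim N(\mathbf{0},\mathbf{I}_p)$.
   Context: A dictionary is a real matrix whose columns (atoms) $\boldsymbol{\varphi}_i$ have unit Euclidean norm. Its coherence is $\max_{i\ne j}|\langle\boldsymbol{\varphi}_i,\boldsymbol{\varphi}_j\rangle|$. For $a<b$, $\mu_{\min}(a,b)$ is the smallest possible coherence of an $a\times b$ dictionary. A vector $\mathbf{x}$ is $m$-sparse if it has exactly $m$ non-zero entries; $\Omega=\operatorname{supp}(\mathbf{x})$ and $x_{\min}=\min_{i\in\Omega}|\mathbf{x}_i|$. It is understood that all expressions are well defined: $\tilde p\ge 1$, $2m-1-Lm\neq 0$, and $\tilde N\ge 3$ (so that the iterated logarithms are positive). OMP (Orthogonal Matching Pursuit) with input $\boldsymbol{\Phi}$, $\mathbf{s}$, $m$: set $\mathbf{r}_0=\mathbf{s}$ and $\hat\Omega_0=\emptyset$. For $t=1,\dots,m$: choose $j\in\arg\max\{|\langle\boldsymbol{\varphi}_i,\mathbf{r}_{t-1}\rangle|: i\in\{1,\dots,N\}\}$; set $\hat\Omega_t=\hat\Omega_{t-1}\cup\{j\}$; let $\hat{\mathbf{x}}_t$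 minimize $\|\mathbf{s}-\boldsymbol{\Phi}\mathbf{z}\|_2$ over $\mathbf{z}\in\mathbb{R}^N$ supported on $\hat\Omega_t$; set $\mathbf{r}_t=\mathbf{s}-\boldsymbol{\Phi}\hat{\mathbf{x}}_t$. The output is $\hat{\mathbf{x}}_m$ with estimated support $\hat\Omega_m$. OMP fails to recover the support of $\mathbf{x}$ if $\hat\Omega_m\ne\Omega$. The pair $(\boldsymbol{\Phi},\mathbf{x})$ is fixed and the probability is over $\boldsymbol{\xi}$. *)

(* Defs.v *)
From HB Require Import structures.
From mathcomp Require Export all_boot all_order all_algebra.
From mathcomp Require Export all_classical all_reals all_analysis.

Set Implicit Arguments.
Unset Strict Implicit.
Unset Printing Implicit Defensive.

Import Order.TTheory GRing.Theory Num.Theory.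
Local Open Scope classical_set_scope.
Local Open Scope ring_scope.

(* The canonical norm [`|u|] on matrices is the sup norm, hence the Euclidean
   structure below. *)
Definition dotp (R : realType) (n : nat) (u v : 'cV[R]_n) : R :=
  \sum_(k < n) u k ord0 * v k ord0.

Definition norm2 (R : realType) (n : nat) (u : 'cV[R]_n) : R :=
  Num.sqrt (dotp u u).

Definition dictionary (R : realType) (a b : nat) (Phi : 'M[R]_(a, b)) : Prop :=
  forall i : 'I_b, norm2 (col i Phi) = 1.

(* The seed 0 of the maximum is harmless, all the terms being nonnegative. *)
Definition coherence (R : realType) (a b : nat) (Phi : 'M[R]_(a, b)) : R :=
  \big[Num.max/0]_(ij : 'I_b * 'I_b | ij.1 != ij.2)
    `|dotp (col ij.1 Phi) (col ij.2 Phi)|.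

(* For 0 < a < b this infimum is a minimum, by compactness of the set of
   a x b dictionaries. *)
Definition mu_min (R : realType) (a b : nat) : R :=
  inf [set coherence Phi | Phi in [set Phi : 'M[R]_(a, b) | dictionary Phi]].

Definition supp (R : realType) (n : nat) (x : 'cV[R]_n) : {set 'I_n} :=
  [set i | x i ord0 != 0]%SET.

Definition sparse (R : realType) (n m : nat) (x : 'cV[R]_n) : Prop :=
  #|supp x| = m.

(* The infimum of a finite set, i.e., its minimum as soon as x != 0. *)
Definition xmin (R : realType) (n : nat) (x : 'cV[R]_n) : R :=
  inf [set `|x i ord0| | i in [set i | i \in supp x]].

Definition least_squares (R : realType) (p N : nat) (Phi : 'M[R]_(p, N))
    (s : 'cV[R]_p) (S : {set 'I_N}) (z : 'cV[R]_N) : Prop :=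
  supp z \subset S /\
  forall z' : 'cV[R]_N, supp z' \subset S ->
    norm2 (s - Phi *m z) <= norm2 (s - Phi *m z').

(* [omp Phi s t S xhat] holds when some execution of OMP on (Phi, s) has, after
   t iterations, estimated support S and estimate xhat.  It is a relation, as
   neither the maximizing index j nor the least-squares solution need be
   unique.  The residual is always [s - Phi *m xhat]; starting from the null
   estimate thus amounts to r_0 = s. *)
Inductive omp (R : realType) (p N : nat) (Phi : 'M[R]_(p, N)) (s : 'cV[R]_p) :
    nat -> {set 'I_N} -> 'cV[R]_N -> Prop :=
| omp_init : omp Phi s 0%N (finset.set0) 0
| omp_step (t : nat) (S : {set 'I_N}) (xhat : 'cV[R]_N) (j : 'I_N)
    (xhat' : 'cV[R]_N) :
    omp Phi s t S xhat ->
    (forall i : 'I_N, `|dotp (col i Phi) (s - Phi *m xhat)|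
                      <= `|dotp (col j Phi) (s - Phi *m xhat)|) ->
    least_squares Phi s (j |: S)%SET xhat' ->
    omp Phi s t.+1 (j |: S)%SET xhat'.

(* Failure whatever the way ties are broken. *)
Definition omp_fails (R : realType) (p N : nat) (Phi : 'M[R]_(p, N))
    (s : 'cV[R]_p) (m : nat) (Omega : {set 'I_N}) : Prop :=
  forall (S : {set 'I_N}) (xhat : 'cV[R]_N), omp Phi s m S xhat -> S <> Omega.

Definition mutually_independent (R : realType) (d : measure_display)
    (T : measurableType d) (P : probability T R) (n : nat)
    (X : 'I_n -> {RV P >-> R}) : Prop :=
  forall (J : {set 'I_n}) (B : 'I_n -> set R), (forall i, measurable (B i)) ->
    P (\big[setI/setT]_(i in J) (X i @^-1` B i))
    = (\prod_(i in J) P (X i @^-1` B i))%E.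

(* The random vector of coordinates X i has law N(0, I_n). *)
Definition standard_gaussian (R : realType) (d : measure_display)
    (T : measurableType d) (P : probability T R) (n : nat)
    (X : 'I_n -> {RV P >-> R}) : Prop :=
  (forall (i : 'I_n) (A : set R), measurable A ->
     distribution P (X i) A = normal_prob 0 1 A)
  /\ mutually_independent X.

(* The set E need not be measurable: the probability bound is that of a
   measurable event contained in E.  For measurable E this says c <= P E. *)
Definition with_prob_ge (R : realType) (d : measure_display)
    (T : measurableType d) (P : probability T R) (c : R) (E : set T) : Prop :=
  exists A : set T, [/\ measurable A, A `<=` E & (c%:E <= P A)%E].

(* Main.v *)
(* The support atoms are taken to have inner products - mu, the other atoms to
   have inner product mu with each of them, and the components of the latter
   orthogonal to the support to form an optimal dictionary Psi (which exists by
   compactness); the conditions on mu say exactly that all inner products between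
   atoms outside the support are then at most mu.  With x constant on its support,
   OMP fails as soon as its first atom is wrong, that is, as soon as the noise
   favours an atom outside the support by more than sigma R.  The noise along the
   support atoms is bounded by normal tails and a union bound.  The noise along
   Psi is a Gaussian vector with correlations at most mu, and its maximum is
   bounded below by Slepian's comparison with an equicorrelated vector.

   Slepian's inequality is proved for products of logistic functions, by replacing
   Gaussians with random walks: one small step of the walk only sees the second
   derivatives of the test function, hence the covariance matrix, and the
   comparison of single steps telescopes. *)

Require Import Defs.
From mathcomp Require Import ring lra measurable_realfun.
Set Implicit Arguments.
Unset Strict Implicit.
Unset Printing Implicit Defensive.
Import Order.TTheory GRing.Theory Num.Theory.
Import numFieldNormedType.Exports.
Local Open Scope classical_set_scope.
Local Open Scope ring_scope.

(** * Integration against the standard normal density *)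

(** The noise on the support atom a is rho Z + V_a, and on the outer atom j it is sqrt(mut) Z +
    sqrt(1 - mut) Y_j: Z is the noise along the mean of the support, V_a the centred remainder, Y_j
    the noise orthogonal to the support. This accounts for the terms of R. The lower bound for max
    Y_j gives the first and the third; a union bound over at most N^beta variables V_a, of variance
    1 - rho^2, gives the second; one tail of Z, met with weight rho on one side and sqrt(mut) on the
    other, gives the last.

    The obstacle is the joint law of the Y_j: independence of the coordinates of [xi] speaks of
    product events, whereas Slepian's comparison speaks of expectations of functions of n variables.
    Expectations are therefore rewritten once as iterated one-dimensional Gaussian smoothings
    ([gausses]), and all later facts about [xi], even the tail of a single linear form, are obtained
    from these operators.

    The constant C = 1/100 is small on purpose: the claimed probability is not positive until the
    square root in its exponent exceeds 100, so the estimates of the maximum may assume that n is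
    huge. *)

Section gaussian_functional.
Variable R : realType.
Implicit Types (F G : R -> R) (z w : R).
Local Notation mu := (@lebesgue_measure R).

Definition phi (z : R) : R := normal_pdf 0 1 z.

Lemma phiE z : phi z = (Num.sqrt (pi *+ 2))^-1 * expR (- z ^+ 2 / 2).
Proof.
by rewrite /phi normal_pdfE ?oner_neq0// /normal_peak /normal_fun subr0 expr1n mul1r.
Qed.

Lemma phi_gt0 z : 0 < phi z.
Proof.
by rewrite phiE mulr_gt0 ?expR_gt0// invr_gt0 sqrtr_gt0 mulrn_wgt0 ?pi_gt0.
Qed.

Lemma phi_ge0 z : 0 <= phi z. Proof. exact: ltW (phi_gt0 z). Qed.

Lemma measurable_phi : measurable_fun setT phi.
Proof. exact: measurable_normal_pdf. Qed.

Lemma continuous_phi : continuous phi.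
Proof. by apply: continuous_normal_pdf; exact: oner_neq0. Qed.

Lemma phiN z : phi (- z) = phi z.
Proof. by rewrite !phiE sqrrN. Qed.

Definition Gint F : Prop := mu.-integrable setT (EFin \o (F \* phi)).

Definition GE F : R := \int[mu]_x (F x * phi x).

Lemma Gint_le F G : measurable_fun setT F -> Gint G ->
  (forall z, `|F z| <= G z) -> Gint F.
Proof.
move=> mF iG FG; apply: le_integrable iG => //.
  by apply/measurable_EFinP; apply: measurable_funM => //; exact: measurable_phi.
move=> z _ /=; rewrite lee_fin !normrM ler_wpM2r//.
exact: le_trans (FG z) (ler_norm _).
Qed.

Lemma Gint_cst c : Gint (fun=> c).
Proof.
have := @integrable_normal_pdf R 0 1 => /(integrableZl measurableT c).
by apply: eq_integrable => //= z _; rewrite /= EFinM.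
Qed.

Lemma Gint_bounded F M : measurable_fun setT F -> (forall z, `|F z| <= M) -> Gint F.
Proof. by move=> mF FM; apply: (Gint_le mF (Gint_cst M)). Qed.

Lemma GintD F G : Gint F -> Gint G -> Gint (fun z => F z + G z).
Proof.
move=> iF iG; have := integrableD measurableT iF iG.
by apply: eq_integrable => //= z _; rewrite /= -EFinD mulrDl.
Qed.

Lemma GintZ c F : Gint F -> Gint (fun z => c * F z).
Proof.
move=> iF; have := integrableZl measurableT c iF.
by apply: eq_integrable => //= z _; rewrite /= -EFinM mulrA.
Qed.

Lemma GE_eq F G : F =1 G -> GE F = GE G.
Proof. by move=> FG; apply: eq_Rintegral => z _; rewrite FG. Qed.

Lemma GED F G : Gint F -> Gint G -> GE (fun z => F z + G z) = GE F + GE G.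
Proof.
move=> iF iG; rewrite /GE -RintegralD//.
by apply: eq_Rintegral => z _; rewrite mulrDl.
Qed.

Lemma GEZ c F : Gint F -> GE (fun z => c * F z) = c * GE F.
Proof.
move=> iF; rewrite /GE -RintegralZl//.
by apply: eq_Rintegral => z _; rewrite mulrA.
Qed.

Lemma GEB F G : Gint F -> Gint G -> GE (fun z => F z - G z) = GE F - GE G.
Proof.
move=> iF iG; rewrite -[- GE G]mulN1r -GEZ// -GED//; last exact: GintZ.
by apply: GE_eq => z; rewrite mulN1r.
Qed.

Lemma GE_cst c : GE (fun=> c) = c.
Proof.
rewrite /GE /Rintegral; under eq_integral do rewrite EFinM.
rewrite integralZl//=; last exact: integrable_normal_pdf.
by rewrite integral_normal_pdf mule1.
Qed.

Lemma GE_le F G : Gint F -> Gint G -> (forall z, F z <= G z) -> GE F <= GE G.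
Proof.
move=> iF iG FG; apply: le_Rintegral => // z _.
by rewrite ler_wpM2r ?phi_ge0.
Qed.

Lemma GE_dist F G e : Gint F -> Gint G -> Gint e ->
  (forall z, `|F z - G z| <= e z) -> `|GE F - GE G| <= GE e.
Proof.
move=> iF iG ie FG; rewrite ler_norml; apply/andP; split.
  rewrite lerNl opprB -GEB//; apply: GE_le => // [|z].
    by rewrite (_ : (fun _ => _) = fun z => G z + (-1) * F z);
      [apply: GintD => //; exact: GintZ | apply/funext => z; ring].
  by rewrite (le_trans (ler_norm _))// distrC.
rewrite -GEB//; apply: GE_le => // [|z].
  by rewrite (_ : (fun _ => _) = fun z => F z + (-1) * G z);
    [apply: GintD => //; exact: GintZ | apply/funext => z; ring].
by rewrite (le_trans (ler_norm _)).
Qed.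

Lemma GE_sum (r : nat) (F : nat -> R -> R) : (forall i, Gint (F i)) ->
  Gint (fun z => \sum_(i < r) F i z) /\
  GE (fun z => \sum_(i < r) F i z) = \sum_(i < r) GE (F i).
Proof.
move=> iF; elim: r => [|r [ir IH]].
  split; last by rewrite big_ord0 -[RHS](GE_cst 0); apply: GE_eq => z; rewrite big_ord0.
  by rewrite (_ : (fun _ => _) = fun=> 0); [exact: Gint_cst|
     apply/funext => z; rewrite big_ord0].
have E : (fun z => \sum_(i < r.+1) F i z) = (fun z => \sum_(i < r) F i z + F r z).
  by apply/funext => z; rewrite big_ord_recr.
by rewrite E; split; [exact: GintD | rewrite GED// IH big_ord_recr].
Qed.

Lemma GE_EFin F : Gint F -> (GE F)%:E = (\int[mu]_x (F x * phi x)%:E)%E.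
Proof.
by move=> iF; rewrite /GE /Rintegral fineK//; exact: integrable_fin_num.
Qed.

Lemma GE_opp F : measurable_fun setT F -> (forall z, 0 <= F z) ->
  GE (fun z => F (- z)) = GE F.
Proof.
move=> mF F0; rewrite /GE /Rintegral; congr fine.
pose h z := ((F z * phi z)%:E : \bar R).
have mh : measurable_fun setT h.
  by apply/measurable_EFinP; apply: measurable_funM => //; exact: measurable_phi.
have h0 z : (0 <= h z)%E by rewrite lee_fin mulr_ge0 ?phi_ge0.
transitivity (\int[mu]_x (h \o (-%R : R -> measurableTypeR R)) x)%E.
  by apply: eq_integral => z _; rewrite /h /= phiN.
rewrite -[X in (integral _ X _ = _)](preimage_setT (-%R : R -> measurableTypeR R)).
rewrite -ge0_integral_pushforward//.
by apply: eq_measure_integral => A mA _; exact: lebesgue_measureN.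
Qed.

End gaussian_functional.

(** * Stability of the normal law and its third absolute moment *)

Section gaussian_semigroup.
Variable R : realType.
Implicit Types (F G : R -> R) (z w : R).
Local Notation mu := (@lebesgue_measure R).

Lemma sqrt2_neq0 : Num.sqrt 2 != 0 :> R.
Proof. by rewrite gt_eqF// sqrtr_gt0. Qed.

Lemma sqr_sqrt2 : Num.sqrt 2 ^+ 2 = 2 :> R.
Proof. by rewrite sqr_sqrtr. Qed.

(** Completing the square: z^2 + (sqrt 2 v - z)^2 = v^2 + 2 (z - v / sqrt 2)^2. Given v = (z + w) /
    sqrt 2, the variable z is normal of mean v / sqrt 2 and variance 1/2. *)
Lemma phi_prod z v : phi z * phi (Num.sqrt 2 * v - z) * Num.sqrt 2 =
  phi v * normal_pdf (v / Num.sqrt 2) (Num.sqrt 2)^-1 z.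
Proof.
have s0 := sqrt2_neq0.
rewrite normal_pdfE ?invr_eq0// /normal_peak /normal_fun !phiE.
set e1 := expR _; set e2 := expR _; set e3 := expR _; set e4 := expR _.
have E : e1 * e2 = e3 * e4.
  rewrite /e1 /e2 /e3 /e4 -!expRD; congr expR.
  rewrite exprVn sqr_sqrt2.
  have -> : (2^-1 *+ 2 : R) = 1 by rewrite mulr2n; field.
  rewrite divr1.
  have vs : v / Num.sqrt 2 = Num.sqrt 2 * v / 2.
    by rewrite -[X in _ = _ / X]sqr_sqrt2; field.
  rewrite vs sqrrB exprMn sqr_sqrt2 [(z - _) ^+ 2]sqrrB !exprMn sqr_sqrt2.
  by field.
have P : Num.sqrt ((Num.sqrt 2)^-1 ^+ 2 * pi *+ 2) = Num.sqrt pi :> R.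
  by rewrite exprVn sqr_sqrt2 mulr2n; congr Num.sqrt; field.
have Q : Num.sqrt (pi *+ 2) = Num.sqrt 2 * Num.sqrt pi :> R.
  have -> : pi *+ 2 = 2 * pi :> R by rewrite mulr2n; ring.
  by rewrite sqrtrM.
have pi0 : Num.sqrt (pi : R) != 0 by rewrite gt_eqF// sqrtr_gt0 pi_gt0.
transitivity ((Num.sqrt (pi *+ 2))^-1 ^+ 2 * Num.sqrt 2 * (e1 * e2)); first by ring.
rewrite E P Q; set s := Num.sqrt 2; set p := Num.sqrt pi.
have -> : (s * p)^-1 ^+ 2 * s * (e3 * e4) = (s * p)^-1 * e3 * (p^-1 * e4) by field; rewrite s0 pi0.
by [].

Qed.

(* For fixed z substitute v = (z + w) / sqrt 2; the z-integral is then that of a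
   normal density, by phi_prod. *)
Lemma GE_semigroup F : continuous F -> (forall z, 0 <= F z <= 1) ->
  GE F = GE (fun z => GE (fun w => F ((z + w) / Num.sqrt 2))).
Proof.
move=> cF F01.
have s0 := sqrt2_neq0.
have s_gt0 : 0 < Num.sqrt 2 :> R by rewrite sqrtr_gt0.
have F0 z : 0 <= F z by case/andP: (F01 z).
have F1 z : `|F z| <= 1 by rewrite ger0_norm//; case/andP: (F01 z).
have mF : measurable_fun setT F := continuous_measurable_fun cF.
have mph := @measurable_phi R.
have cFz z : continuous (fun w => F ((z + w) / Num.sqrt 2)).
  move=> w; apply: continuous_comp; last exact: cF.
  by apply: cvgM; [apply: cvgD; [exact: cvg_cst|exact: cvg_id]|exact: cvg_cst].
have H z : (GE (fun w => F ((z + w) / Num.sqrt 2)))%:E =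
   (\int[mu]_v (F v * phi (Num.sqrt 2 * v - z) * Num.sqrt 2)%:E)%E.
  rewrite GE_EFin; last first.
    by apply: (@Gint_bounded _ _ 1) => //; exact: continuous_measurable_fun.
  pose h (v : R) := Num.sqrt 2 * v - z : R.
  have dh (v : R) : is_derive v 1 h (Num.sqrt 2).
    by apply: is_derive_eq; rewrite /GRing.scale/= subr0 mulr1.
  have h' : (h^`())%classic = cst (Num.sqrt 2).
    by apply/funext => v; rewrite derive1E; exact: (@derive_val _ _ _ _ _ _ _ (dh v)).
  rewrite (@increasing_ge0_integration_by_substitutionT _ h
      (fun w => F ((z + w) / Num.sqrt 2) * phi w)).
  - apply: eq_integral => v _; congr EFin; rewrite h' /= /h; congr (F _ * _ * _).
    by rewrite addrC subrK mulrC mulKf.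
  - by move=> x y xy; rewrite /h ltrD2r ltr_pM2l.
  - by rewrite h' => ?; exact: cvg_cst.
  - by rewrite h'; exact: is_cvg_cst.
  - by rewrite h'; exact: is_cvg_cst.
  - by move=> v; exact: (@ex_derive _ _ _ _ _ _ _ (dh v)).
  - apply: (@cvg_comp _ _ _ (fun v => Num.sqrt 2 * v) (fun u => u - z) _ -oo%R).
      by apply/gt0_cvgMrNy => //; exact: cvg_id.
    exact: cvg_addrr_Ny.
  - apply: (@cvg_comp _ _ _ (fun v => Num.sqrt 2 * v) (fun u => u - z) _ +oo%R).
      by apply/gt0_cvgMry => //; exact: cvg_id.
    exact: cvg_addrr.
  - by move=> w; apply: cvgM; [exact: cFz|exact: continuous_phi].
  - by move=> w; rewrite mulr_ge0 ?phi_ge0.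
pose J (p : R * R) := ((F p.2 * phi (Num.sqrt 2 * p.2 - p.1) * Num.sqrt 2 * phi p.1)%:E : \bar R).
have mJ : measurable_fun setT J.
  apply/measurable_EFinP; apply: measurable_funM; last first.
    exact: (measurableT_comp mph measurable_fst).
  apply: measurable_funM => //; apply: measurable_funM.
    exact: (measurableT_comp mF measurable_snd).
  apply: (measurableT_comp mph); apply: measurable_funB; last exact: measurable_fst.
  by apply: measurable_funM => //; exact: measurable_snd.
have J0 p : (0 <= J p)%E by rewrite lee_fin !mulr_ge0 ?phi_ge0.
have E z : ((GE (fun w => F ((z + w) / Num.sqrt 2)) * phi z)%:E : \bar R) =
    (\int[mu]_v J (z, v))%E.
  rewrite EFinM H muleC -ge0_integralZl//=.
  - by apply: eq_integral => v _; rewrite /J -EFinM mulrC.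
  - apply/measurable_EFinP; apply: measurable_funM => //; apply: measurable_funM => //.
    apply: (measurableT_comp mph); apply: measurable_funB => //.
  - by move=> v _; rewrite lee_fin !mulr_ge0 ?phi_ge0.
  - by rewrite lee_fin phi_ge0.
rewrite /GE /Rintegral -/(GE _); congr fine.
transitivity (\int[mu]_z \int[mu]_v J (z, v))%E; last first.
  by apply: eq_integral => z _; rewrite -E.
rewrite fubini_tonelli//; apply: eq_integral => v _.
transitivity (\int[mu]_z ((F v * phi v)%:E * (normal_pdf (v / Num.sqrt 2) (Num.sqrt 2)^-1 z)%:E))%E.
  rewrite integralZl//=; last exact: integrable_normal_pdf.
  by rewrite integral_normal_pdf mule1.
apply: eq_integral => z _; rewrite /J -EFinM; congr EFin => /=.
by rewrite -[LHS]mulrA -phi_prod; ring.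
Qed.

(** With y = |z|, the exponential is at least (1 + y^2 / 8)^2, whose leading term is y^4 / 64. The
    constant 33 suffices because y^3 <= (y^4 + y^2) / 2 and 33 / 64 > 1 / 2. *)
Lemma norm3_le_exp z : `|z| ^+ 3 <= 33 * expR (z ^+ 2 / 4).
Proof.
have -> : z ^+ 2 = `|z| ^+ 2 by rewrite -normrX ger0_norm ?sqr_ge0.
set y := `|z|.
have y0 : 0 <= y by exact: normr_ge0.
have H : 1 + (y ^+ 2 / 8) <= expR (y ^+ 2 / 8) by exact: expR_ge1Dx.
have -> : expR (y ^+ 2 / 4) = expR (y ^+ 2 / 8) ^+ 2.
  by rewrite -expRM_natl; congr expR; field.
have H1 : (1 + (y ^+ 2 / 8)) ^+ 2 <= expR (y ^+ 2 / 8) ^+ 2.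
  by rewrite lerXn2r// nnegrE ?expR_ge0// addr_ge0// divr_ge0// sqr_ge0.
apply: le_trans (_ : 33 * (1 + y ^+ 2 / 8) ^+ 2 <= _); last by rewrite ler_pM2l.
have : 0 <= (y ^+ 2 - y) ^+ 2 by exact: sqr_ge0.
have : 0 <= (y - 1) ^+ 2 by exact: sqr_ge0.
have : 0 <= y ^+ 2 by exact: sqr_ge0.
have : 0 <= (y^+2 - 1) ^+ 2 by exact: sqr_ge0.
nra.
Qed.

(** By [norm3_le_exp] the integrand is dominated by a multiple of the normal density of variance 2;
    the factor sqrt 2 is the ratio of the two normalizations. *)
Lemma Gint_norm3 : Gint (fun z : R => `|z| ^+ 3).
Proof.
have := integrable_normal_pdf (0 : R) (Num.sqrt 2) =>
  /(integrableZl measurableT (33 * Num.sqrt 2)).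
apply: le_integrable => //.
  apply/measurable_EFinP; apply: measurable_funM; last exact: measurable_phi.
  by apply: measurable_funX; exact: normr_measurable.
move=> z _; rewrite /= lee_fin !normrM normr_id (ger0_norm (phi_ge0 _)).
rewrite (ger0_norm (normal_pdf_ge0 _ _ _)).
rewrite (@ger0_norm _ 33)// (ger0_norm (sqrtr_ge0 _)).
rewrite normal_pdfE ?sqrt2_neq0// /normal_peak /normal_fun phiE subr0 sqr_sqrt2.
have -> : 2 * pi *+ 2 = 2 * (pi *+ 2) :> R by rewrite -mulrnAr.
rewrite (sqrtrM (pi *+ 2))//.
set c := Num.sqrt (pi *+ 2); set e := expR _; set e' := expR _.
have c0 : 0 < c by rewrite sqrtr_gt0 mulrn_wgt0 ?pi_gt0.
have -> : 33 * Num.sqrt 2 * ((Num.sqrt 2 * c)^-1 * e') = 33 * e' / c.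
  by field; rewrite sqrt2_neq0 gt_eqF.
rewrite [leLHS](_ : _ = `|z| ^+ 3 * e / c); last by ring.
rewrite ler_pM2r ?invr_gt0//.
have -> : e' = e * expR (z ^+ 2 / 4).
  by rewrite /e /e' -expRD; congr expR; field.
by rewrite mulrCA [leLHS]mulrC ler_wpM2l ?expR_ge0// norm3_le_exp.
Qed.

End gaussian_semigroup.

(** * Random walks and Gaussian smoothing *)

Section walks.
Variables (R : realType) (n : nat).
Local Notation V := 'rV[R]_n.
Implicit Types (f g : V -> R) (x a b v : V) (l : seq V) (D : V -> V -> R).

(** The l1 norm, for which a product of [0, 1]-valued functions of single coordinates keeps the
    Lipschitz constant of its factors. *)
Definition nm1 v : R := \sum_j `|v ord0 j|.

Lemma nm1_ge0 v : 0 <= nm1 v. Proof. exact: sumr_ge0. Qed.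

Lemma nm1Z c v : nm1 (c *: v) = `|c| * nm1 v.
Proof. by rewrite /nm1 mulr_sumr; apply: eq_bigr => j _; rewrite mxE normrM. Qed.

Lemma nm1N v : nm1 (- v) = nm1 v.
Proof. by rewrite -scaleN1r nm1Z normrN1 mul1r. Qed.

(** A regularity class preserved by [walk] and [gauss] with the same [L]; it makes every integral
    along a line meaningful. *)
Definition tame (L : R) f : Prop :=
  (forall x, 0 <= f x <= 1) /\ (forall x v, `|f (x + v) - f x| <= L * nm1 v).

Lemma tame_continuous L f x a : tame L f -> continuous (fun z : R => f (x + z *: a)).
Proof.
move=> [_ fL] z; apply/cvgrPdist_le => e e0.
have Lp : 0 < `|L| * nm1 a + 1 by rewrite ltr_wpDl// mulr_ge0// nm1_ge0.
near=> w.
have -> : x + z *: a = (x + w *: a) + (z - w) *: a.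
  by rewrite -addrA -scalerDl (addrC w) subrK.
apply: le_trans (fL _ _) _; rewrite nm1Z.
have H : `|z - w| <= e / (`|L| * nm1 a + 1).
  near: w; apply: cvgr_dist_le; last by rewrite divr_gt0.
  exact: cvg_id.
apply: le_trans (_ : `|L| * (`|z - w| * nm1 a) <= _).
  by rewrite ler_wpM2r ?ler_norm// mulr_ge0// nm1_ge0.
rewrite mulrCA; apply: le_trans (_ : `|z - w| * (`|L| * nm1 a + 1) <= _).
  by rewrite ler_wpM2l// lerDl.
by rewrite -ler_pdivlMr.
Unshelve. all: by end_near. Qed.

Lemma tame_line_measurable L f x a : tame L f ->
  measurable_fun setT (fun z : R => f (x + z *: a)).
Proof. by move=> tf; apply: continuous_measurable_fun; exact: tame_continuous tf. Qed.

Lemma tame_Gint L f x a : tame L f -> Gint (fun z : R => f (x + z *: a)).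
Proof.
move=> tf; apply: (@Gint_bounded _ _ 1); first exact: tame_line_measurable tf.
by move=> z; case: tf => /(_ (x + z *: a))/andP[f0 f1] _; rewrite ger0_norm.
Qed.

(* walk l f x is the mean of f(x + sum_i e_i a_i) over independent uniform signs
   e_i.  Working with walks rather than with Gaussians makes the operators
   commute without any appeal to Fubini. *)
Fixpoint walk l f x : R :=
  if l is a :: l' then (walk l' f (x + a) + walk l' f (x - a)) / 2 else f x.

Definition gauss a f x : R := GE (fun z : R => f (x + z *: a)).

Definition gausses l f : V -> R := foldr gauss f l.

Lemma walk_cat l1 l2 f x : walk (l1 ++ l2) f x = walk l1 (walk l2 f) x.
Proof. by elim: l1 x => //= a l1 IH x; rewrite !IH. Qed.

Lemma walk_le l f g : (forall x, f x <= g x) -> forall x, walk l f x <= walk l g x.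
Proof.
move=> fg; elim: l => //= a l IH x.
by rewrite ler_pM2r ?invr_gt0//; apply: lerD.
Qed.

Lemma walk_addc l f c x : walk l (fun x => f x + c) x = walk l f x + c.
Proof. by elim: l x => //= a l IH x; rewrite !IH; field. Qed.

Lemma walk_dist l f g e : (forall x, `|f x - g x| <= e) ->
  forall x, `|walk l f x - walk l g x| <= e.
Proof.
move=> fg; elim: l => //= a l IH x.
move: (IH (x + a)) (IH (x - a)); rewrite !ler_norml => /andP[? ?] /andP[? ?].
by apply/andP; split; lra.
Qed.

Lemma walk_swap a b l f x : walk [:: a, b & l] f x = walk [:: b, a & l] f x.
Proof.
rewrite /= (addrAC x b a) (addrAC x b (- a)) (addrAC x (- b) a).
by rewrite (addrAC x (- b) (- a)); field.
Qed.

Lemma walk_rem a l f x : a \in l -> walk l f x = walk (a :: rem a l) f x.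
Proof.
elim: l x => //= b l IH x; rewrite in_cons eq_sym.
have [->//|ba /= al] := eqVneq b a.
by rewrite !IH//; exact: (walk_swap b a (rem a l) f x).
Qed.

Lemma walk_perm l1 l2 f x : perm_eq l1 l2 -> walk l1 f x = walk l2 f x.
Proof.
elim: l1 l2 x => [|a l1 IH] l2 x; first by rewrite perm_sym => /perm_nilP ->.
move=> p; have al2 : a \in l2 by rewrite -(perm_mem p) mem_head.
rewrite (walk_rem _ _ al2) /=.
have p' : perm_eq l1 (rem a l2).
  by rewrite -(perm_cons a) (permPl p) perm_to_rem.
by rewrite !(IH _ _ p').
Qed.

Lemma walk_comm l1 l2 f x : walk l1 (walk l2 f) x = walk l2 (walk l1 f) x.
Proof. by rewrite -!walk_cat; apply: walk_perm; rewrite perm_catC. Qed.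

Lemma tame_walk L l f : tame L f -> tame L (walk l f).
Proof.
move=> [f01 fL]; split; last first.
  move=> x v; elim: l x => //= a l IH x.
  rewrite (addrAC x v a) (addrAC x v (- a)).
  move: (IH (x + a)) (IH (x - a)); rewrite !ler_norml => /andP[? ?] /andP[? ?].
  by apply/andP; split; lra.
elim: l => //= a l IH x.
by move: (IH (x + a)) (IH (x - a)) => /andP[? ?] /andP[? ?]; apply/andP; split; lra.
Qed.

Lemma tame_gauss L a f : tame L f -> tame L (gauss a f).
Proof.
move=> tf; have [f01 fL] := tf; split.
  move=> x; rewrite /gauss; apply/andP; split.
    rewrite -(GE_cst (0 : R)); apply: GE_le => //; [exact: Gint_cst|exact: tame_Gint tf|].
    by move=> z; case/andP: (f01 (x + z *: a)).
  rewrite -[leRHS](GE_cst (1 : R)); apply: GE_le => //; [exact: tame_Gint tf|exact: Gint_cst|].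
  by move=> z; case/andP: (f01 (x + z *: a)).
move=> x v; rewrite /gauss -[leRHS](GE_cst (L * nm1 v)).
apply: GE_dist; [exact: tame_Gint tf|exact: tame_Gint tf|exact: Gint_cst|].
by move=> z; rewrite addrAC.
Qed.

Lemma tame_gausses L l f : tame L f -> tame L (gausses l f).
Proof. by move=> tf; elim: l => //= a l; exact: tame_gauss. Qed.

Lemma gauss_dist L a f g e : tame L f -> tame L g -> (forall x, `|f x - g x| <= e) ->
  forall x, `|gauss a f x - gauss a g x| <= e.
Proof.
move=> tf tg fg x; rewrite -[leRHS](GE_cst e).
by apply: GE_dist => //; [exact: tame_Gint tf|exact: tame_Gint tg|exact: Gint_cst].
Qed.

(** A walk is a finite average, so linearity of the integral is enough. *)
Lemma gauss_walk L b l f x : tame L f -> gauss b (walk l f) x = walk l (gauss b f) x.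
Proof.
move=> tf; elim: l x => //= a l IH x.
have tw := tame_walk l tf.
rewrite -!IH /gauss -GED; [|exact: tame_Gint tw|exact: tame_Gint tw].
rewrite mulrC -GEZ; last by apply: GintD; exact: tame_Gint tw.
by apply: GE_eq => z; rewrite mulrC [x + a + _]addrAC [x - a + _]addrAC.
Qed.

(** A Gaussian step is two independent Gaussian steps of half the variance; this drives the doubling
    in [gauss_clt]. *)
Lemma gauss_split L a f x : tame L f ->
  gauss a f x = gauss ((Num.sqrt 2)^-1 *: a) (gauss ((Num.sqrt 2)^-1 *: a) f) x.
Proof.
move=> tf; have f01 z : 0 <= f (x + z *: a) <= 1 by case: tf.
rewrite {1}/gauss (GE_semigroup (@tame_continuous L f x a tf) f01).
rewrite /gauss; apply: GE_eq => z; apply: GE_eq => w; congr f.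
by rewrite !scalerA -addrA -scalerDl -mulrDl.
Qed.

(* D x a stands for the second derivative of f at x along a. *)
Definition smooth2 (C : R) f D : Prop :=
  [/\ 0 <= C,
      forall x a, `|(f (x + a) + f (x - a)) / 2 - f x - D x a / 2| <= C * nm1 a ^+ 3,
      forall x a b, `|D (x + a) b - D x b| <= C * (nm1 a * nm1 b ^+ 2) &
      forall x c b, D x (c *: b) = c ^+ 2 * D x b].

(** With s the length of the remaining steps, the first step a costs C |a|^3, moving the base point
    of [D] from x to x + a or x - a costs at most C |a| s^2, and induction gives C s^3. All fit into
    C (|a| + s)^3. *)
Lemma walk_expand C f D l x : smooth2 C f D ->
  `|walk l f x - f x - (\sum_(a <- l) D x a) / 2| <= C * (\sum_(a <- l) nm1 a) ^+ 3.
Proof.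
case=> C0 fD DD _; elim: l x => [|a l IH] x.
  by rewrite !big_nil /= subrr mul0r subr0 normr0 expr0n mulr0.
rewrite !big_cons /=.
have DDs y : `|\sum_(b <- l) D (x + y) b - \sum_(b <- l) D x b|
    <= C * (nm1 y * (\sum_(b <- l) nm1 b) ^+ 2).
  rewrite -sumrB (le_trans (ler_norm_sum _ _ _))//.
  rewrite (le_trans (ler_sum _ (fun b _ => DD x y b)))// -!mulr_sumr.
  rewrite ler_wpM2l// ler_wpM2l ?nm1_ge0//.
  elim: (l) => [|b l' IH']; first by rewrite !big_nil expr0n.
  rewrite !big_cons sqrrD.
  have : 0 <= nm1 b * \sum_(j <- l') nm1 j by rewrite mulr_ge0 ?nm1_ge0// sumr_ge0// => *; exact: nm1_ge0.
  by move: IH'; set s1 := \sum_(i <- _) _; set s2 := \sum_(i <- _) _; lra.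
have s0 : 0 <= \sum_(j <- l) nm1 j by apply: sumr_ge0 => *; exact: nm1_ge0.
have a0 := nm1_ge0 a.
move: (fD x a) (DDs a) (DDs (- a)) (IH (x + a)) (IH (x - a)) => H1 H2 H3 H4 H5.
rewrite nm1N in H3.
move: H1 H2 H3 H4 H5.
set s := \sum_(j <- l) nm1 j in s0 *.
set d0 := \sum_(b <- l) D x b; set d1 := \sum_(b <- l) D (x + a) b.
set d2 := \sum_(b <- l) D (x - a) b.
set w1 := walk l f (x + a); set w2 := walk l f (x - a).
set A := nm1 a in a0 *.
have Cas : 0 <= C * (A * s ^+ 2) by rewrite !mulr_ge0// sqr_ge0.
have Caas : 0 <= C * (A ^+ 2 * s) by rewrite !mulr_ge0// sqr_ge0.
have -> : C * (A + s) ^+ 3 = C * A ^+ 3 + C * s ^+ 3 + 3 * (C * (A * s ^+ 2)) + 3 * (C * (A ^+ 2 * s)).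
  by ring.
rewrite !ler_norml => /andP[? ?] /andP[? ?] /andP[? ?] /andP[? ?] /andP[? ?].
by apply/andP; split; lra.
Qed.

(* gvar equals 1, but this value is never needed: it scales both sides of the
   comparison. *)
Definition gvar : R := GE (fun z : R => z ^+ 2).
Definition gmom3 : R := GE (fun z : R => `|z| ^+ 3).

Lemma Gint_sqr : Gint (fun z : R => z ^+ 2).
Proof.
apply: (@Gint_le _ _ (fun z => 1 + `|z| ^+ 3)).
- exact: measurable_funX.
- by apply: GintD; [exact: Gint_cst|exact: Gint_norm3].
move=> z; rewrite normrX; set y := `|z|.
have y0 : 0 <= y by exact: normr_ge0.
have := mulr_ge0 y0 (sqr_ge0 (y - 1)); have := sqr_ge0 (y - 1); nra.
Qed.

Lemma gvar_ge0 : 0 <= gvar.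
Proof.
rewrite -(GE_cst (0 : R)); apply: GE_le => [||z]; [exact: Gint_cst|exact: Gint_sqr|exact: sqr_ge0].
Qed.

Lemma gmom3_ge0 : 0 <= gmom3.
Proof.
rewrite -(GE_cst (0 : R)); apply: GE_le => [||z]; [exact: Gint_cst|exact: Gint_norm3|].
by rewrite exprn_ge0.
Qed.

(** Symmetrization puts the integrand in the form of the second-order expansion in [smooth2], which
    has no first-order term. *)
Lemma gauss_sym L a f x : tame L f ->
  gauss a f x = GE (fun z : R => (f (x + z *: a) + f (x - z *: a)) / 2).
Proof.
move=> tf; have ti := tame_Gint x a tf; have ti' := tame_Gint x (- a) tf.
have -> : (fun z : R => (f (x + z *: a) + f (x - z *: a)) / 2) =
  (fun z => 2^-1 * (f (x + z *: a) + f (x + z *: (- a)))).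
  by apply/funext => z; rewrite mulrC scalerN.
rewrite GEZ ?GED//; last exact: GintD.
have -> : GE (fun z : R => f (x + z *: (- a))) = gauss a f x.
  rewrite /gauss -[RHS]GE_opp; first by apply: GE_eq => z; rewrite scalerN scaleNr.
    exact: tame_line_measurable tf.
  by move=> z; case: tf => /(_ (x + z *: a))/andP[].
by rewrite -/(gauss a f x); field.
Qed.

Lemma gauss_expand L C f D a x : tame L f -> smooth2 C f D ->
  `|gauss a f x - (f x + gvar * (D x a / 2))| <= C * gmom3 * nm1 a ^+ 3.
Proof.
move=> tf [C0 fD _ DZ]; rewrite (gauss_sym _ _ tf).
have ti := tame_Gint x a tf; have ti' := tame_Gint x (- a) tf.
have -> : f x + gvar * (D x a / 2) = GE (fun z : R => f x + (D x a / 2) * z ^+ 2).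
  rewrite GED; [|exact: Gint_cst|exact: (GintZ _ Gint_sqr)].
  by rewrite GE_cst GEZ ?[_ * gvar]mulrC//; exact: Gint_sqr.
have -> : C * gmom3 * nm1 a ^+ 3 = GE (fun z : R => (C * nm1 a ^+ 3) * `|z| ^+ 3).
  by rewrite GEZ; [rewrite -/gmom3; ring|exact: Gint_norm3].
apply: GE_dist.
- rewrite [X in Gint X](_ : _ = fun z => 2^-1 * (f (x + z *: a) + f (x + z *: (- a)))).
    by apply: GintZ; exact: GintD.
  by apply/funext => z; rewrite mulrC scalerN.
- by apply: GintD; [exact: Gint_cst|apply: GintZ; exact: Gint_sqr].
- by apply: GintZ; exact: Gint_norm3.
move=> z; have := fD x (z *: a); rewrite DZ nm1Z exprMn.
set u := f (x + _); set w := f (x - _).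
have -> : (u + w) / 2 - f x - z ^+ 2 * D x a / 2 = (u + w) / 2 - (f x + D x a / 2 * z ^+ 2) by ring.
by move=> /le_trans; apply; rewrite mulrA mulrAC.
Qed.

Definition cltC (C : R) := C * gmom3 + C * Num.sqrt gvar ^+ 3.

(** A normal step and a fair sign step of the same variance have the same second-order term, so only
    the two cubic errors collected in [cltC] remain. *)
Lemma gauss_step L C f D a x : tame L f -> smooth2 C f D ->
  `|gauss a f x - walk [:: Num.sqrt gvar *: a] f x| <= cltC C * nm1 a ^+ 3.
Proof.
move=> tf sf; have H1 := gauss_expand a x tf sf.
have := walk_expand [:: Num.sqrt gvar *: a] x sf.
case: sf => _ _ _ DZ; rewrite !big_seq1 DZ sqr_sqrtr ?gvar_ge0// nm1Z.
rewrite (ger0_norm (sqrtr_ge0 _)) exprMn; move: H1; rewrite /cltC.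
set w := walk _ _ _; set g := gauss _ _ _.
rewrite !ler_norml => /andP[? ?] /andP[? ?]; apply/andP; split; lra.
Qed.

(** The scale 2^(-k/2), at which 2^k steps have total variance one. *)
Definition rsc (k : nat) : R := (Num.sqrt 2)^-1 ^+ k.

Lemma rsc_ge0 k : 0 <= rsc k.
Proof. by rewrite exprn_ge0// invr_ge0 sqrtr_ge0. Qed.

Lemma rsc_sqr k : rsc k ^+ 2 *+ (2 ^ k) = 1.
Proof.
rewrite /rsc exprAC exprVn sqr_sqrt2 -mulr_natr natrX exprVn mulVf//.
Qed.

Definition cut (k : nat) a : seq V := nseq (2 ^ k) ((Num.sqrt gvar * rsc k) *: a).

(* Central limit theorem by Lindeberg's method along the doubling sequence 2^k. *)
Lemma gauss_clt L C f D k a x : tame L f -> smooth2 C f D ->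
  `|gauss a f x - walk (cut k a) f x| <= rsc k * (cltC C * nm1 a ^+ 3).
Proof.
move=> tf sf; elim: k a x => [|k IH] a x.
  by rewrite /cut /rsc expn0 expr0 mulr1 mul1r; exact: (gauss_step a x tf sf).
have s0 := sqrt2_neq0 R.
set b := (Num.sqrt 2)^-1 *: a.
have -> : cut k.+1 a = cut k b ++ cut k b.
  rewrite /cut expnS mul2n -addnn nseqD; congr (nseq _ _ ++ nseq _ _);
  by rewrite /b scalerA; congr (_ *: _); rewrite /rsc exprSr; ring.
rewrite (gauss_split _ _ tf) -/b walk_cat.
have tw := tame_walk (cut k b) tf; have tg := tame_gauss b tf.
have H1 := gauss_dist b tg tw (IH b) x.
have H2 := walk_dist (cut k b) (IH b) x.
rewrite (gauss_walk _ _ _ tf) in H1.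
(* Two halves, each with cubic error smaller by 2^(-3/2): the gain per doubling is 2 * 2^(-3/2) =
   2^(-1/2). *)
have E : rsc k.+1 * (cltC C * nm1 a ^+ 3) = 2 * (rsc k * (cltC C * nm1 b ^+ 3)).
  rewrite /b nm1Z ger0_norm ?invr_ge0 ?sqrtr_ge0// /rsc exprS exprMn.
  have -> : (Num.sqrt 2)^-1 ^+ 3 = (Num.sqrt 2)^-1 / 2 :> R by rewrite exprS exprVn sqr_sqrt2.
  by field.
rewrite E; move: H1 H2.
by rewrite !ler_norml => /andP[? ?] /andP[? ?]; apply/andP; split; lra.
Qed.

Lemma gausses_clt L C f D k l x : tame L f -> smooth2 C f D ->
  `|gausses l f x - walk (flatten (map (cut k) l)) f x|
    <= rsc k * (cltC C * \sum_(a <- l) nm1 a ^+ 3).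
Proof.
move=> tf sf; elim: l x => [|a l IH] x /=.
  by rewrite big_nil subrr normr0 !mulr0.
rewrite walk_cat walk_comm big_cons.
have tw := tame_walk (flatten (map (cut k) l)) tf; have tg := tame_gausses l tf.
have H1 := gauss_dist a tg tw IH x.
have H2 := walk_dist (flatten (map (cut k) l)) (fun y => gauss_clt k a y tf sf) x.
rewrite (gauss_walk _ _ _ tf) in H1.
rewrite -/(gausses l f) mulrDr mulrDr; move: H1 H2.
by rewrite !ler_norml => /andP[? ?] /andP[? ?]; apply/andP; split; lra.
Qed.

(** Steps grouped by direction are regrouped into 2^k rounds, each with one small step in every
    direction. The second-order term of a round involves the sum of [D] over all of [l], which is
    the quantity that [gausses_le] compares. *)
Lemma perm_cut k l : perm_eq (flatten (map (cut k) l))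
  (flatten (nseq (2 ^ k) (map (fun a => (Num.sqrt gvar * rsc k) *: a) l))).
Proof.
apply/permP => p; rewrite !count_flatten map_nseq sumn_nseq -map_comp.
elim: l => //= a l ->; rewrite /cut count_nseq mulnDl; congr (_ + _)%N.
Qed.

(** Rounds are exchanged one at a time. The hypothesis holds at every point, so it survives
    averaging by the other rounds, which commute with the one exchanged. *)
Lemma walk_compare l1 l2 f e K x :
  (forall x, walk l1 f x <= walk l2 f x + e) ->
  walk (flatten (nseq K l1)) f x <= walk (flatten (nseq K l2)) f x + e *+ K.
Proof.
move=> H; elim: K x => [|K IH] x /=; first by rewrite addr0.
rewrite !walk_cat walk_comm mulrSr addrA.
apply: le_trans (walk_le (flatten (nseq K l1)) H x) _.
rewrite walk_addc lerD2r walk_comm -walk_addc.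
exact: walk_le.
Qed.

(* Cut into 2^k steps of size 2^(-k/2), one step costs O(2^(-3k/2)) more than the
   second-order term, so the total error is O(2^(-k/2)). *)
Lemma gausses_le L C f D l1 l2 x : tame L f -> smooth2 C f D ->
  (forall x, \sum_(a <- l1) D x a <= \sum_(a <- l2) D x a) ->
  gausses l1 f x <= gausses l2 f x.
Proof.
move=> tf sf DD.
pose S1 := \sum_(a <- l1) nm1 a; pose S2 := \sum_(a <- l2) nm1 a.
pose B := Num.sqrt gvar ^+ 3 * (C * (S1 ^+ 3 + S2 ^+ 3)) +
  (cltC C * \sum_(a <- l1) nm1 a ^+ 3) + (cltC C * \sum_(a <- l2) nm1 a ^+ 3).
have key k : gausses l1 f x - gausses l2 f x <= rsc k * B.
  have st h y : 0 <= h -> walk (map (fun a => h *: a) l1) f y <=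
      walk (map (fun a => h *: a) l2) f y + C * h ^+ 3 * (S1 ^+ 3 + S2 ^+ 3).
    move=> h0.
    have E1 := walk_expand (map (fun a => h *: a) l1) y sf.
    have E2 := walk_expand (map (fun a => h *: a) l2) y sf.
    move: E1 E2; rewrite !big_map.
    have eqn l' : \sum_(i <- l') nm1 (h *: i) = h * \sum_(i <- l') nm1 i.
      by rewrite mulr_sumr; apply: eq_bigr => i _; rewrite nm1Z ger0_norm.
    have eqD l' : \sum_(i <- l') D y (h *: i) = h ^+ 2 * \sum_(i <- l') D y i.
      by rewrite mulr_sumr; apply: eq_bigr => i _; case: sf => _ _ _ ->.
    rewrite !eqn !eqD !exprMn.
    have := ler_wpM2l (sqr_ge0 h) (DD y).
    rewrite -/S1 -/S2 !ler_norml => ? /andP[? ?] /andP[? ?]; lra.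
  pose h := Num.sqrt gvar * rsc k.
  have h0 : 0 <= h by rewrite mulr_ge0 ?sqrtr_ge0 ?rsc_ge0.
  have := walk_compare (2 ^ k) x (fun y => st h y h0).
  rewrite -!(walk_perm _ _ (perm_cut k _)).
  have := gausses_clt k l1 x tf sf; have := gausses_clt k l2 x tf sf.
  have -> : C * h ^+ 3 * (S1 ^+ 3 + S2 ^+ 3) *+ 2 ^ k =
     rsc k * (Num.sqrt gvar ^+ 3 * (C * (S1 ^+ 3 + S2 ^+ 3))).
    have -> : C * h ^+ 3 * (S1 ^+ 3 + S2 ^+ 3) =
      (rsc k * (Num.sqrt gvar ^+ 3 * (C * (S1 ^+ 3 + S2 ^+ 3)))) * rsc k ^+ 2.
      by rewrite /h; ring.
    by rewrite -mulrnAr rsc_sqr mulr1.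
  rewrite /B mulrDr mulrDr.
  rewrite !ler_norml => /andP[? ?] /andP[? ?] ?; lra.
have r0 : rsc k * B @[k --> \oo] --> 0.
  rewrite -[X in _ --> X](mul0r B); apply: cvgMl; apply: cvg_expr.
  rewrite ger0_norm ?invr_ge0 ?sqrtr_ge0// invf_lt1 ?sqrtr_gt0//.
  by rewrite -[ltLHS]sqrtr1 ltr_sqrt// ltr1n.
rewrite -subr_le0 -(cvg_lim _ r0)//; apply: limr_ge; first by apply/cvg_ex; exists 0.
by near=> k; exact: key.
Unshelve. all: by end_near. Qed.

End walks.

(** * Slepian's inequality *)

Section logistic.
Variable R : realType.

Lemma mvt_bound (h dh : R -> R) (c K : R) : 0 <= c ->
  (forall s : R, is_derive s 1 h (dh s)) -> (forall s, 0 <= s <= c -> `|dh s| <= K) ->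
  `|h c - h 0| <= K * c.
Proof.
move=> c0 dhh hK.
have ch : {within `[0, c], continuous h}.
  apply: continuous_subspaceT => s; apply: differentiable_continuous.
  exact/derivable1_diffP/(@ex_derive _ _ _ _ _ _ _ (dhh s)).
have [d] := MVT_segment c0 (fun s _ => dhh s) ch.
rewrite in_itv/= => dc ->; rewrite subr0 normrM (ger0_norm c0).
by rewrite ler_wpM2r// hK.
Qed.

(** The function h(s) + h(-s) - s^2 h2(0) has a derivative vanishing at 0, so two mean value
    estimates bound its increment from 0 to 1. *)
Lemma second_difference (h h1 h2 : R -> R) (K : R) :
  (forall s : R, is_derive s 1 h (h1 s)) -> (forall s : R, is_derive s 1 h1 (h2 s)) ->
  (forall s, `|h2 s - h2 0| <= K * `|s|) ->
  `|(h 1 + h (- 1)) / 2 - h 0 - h2 0 / 2| <= K.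
Proof.
move=> dh dh1 hK.
have dcomp (k k1 : R -> R) : (forall s : R, is_derive s 1 k (k1 s)) ->
    forall s : R, is_derive s 1 (fun s => k (- s)) (- k1 (- s)).
  move=> dk s; have := @is_derive1_comp _ k -%R s _ _ (dk (- s)) (is_deriveN (is_derive_id s 1)).
  by move=> /is_derive_eq; apply; rewrite mulrN1.
pose psi (s : R) := h s + h (- s) - s ^+ 2 * h2 0.
pose chi (s : R) := h1 s - h1 (- s) - 2 * s * h2 0.
have dpsi (s : R) : is_derive s 1 psi (chi s).
  have := dcomp _ _ dh s => d1.
  apply: is_derive_eq; rewrite /chi /GRing.scale/=; ring.
have dchi (s : R) : is_derive s 1 chi (h2 s + h2 (- s) - 2 * h2 0).
  have := dcomp _ _ dh1 s => d1.
  apply: is_derive_eq; rewrite /GRing.scale/=; ring.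
have H : `|psi 1 - psi 0| <= (2 * K) * 1.
  apply: (mvt_bound ler01 dpsi) => s /andP[s0 s1].
  have chi0 : chi 0 = 0 by rewrite /chi oppr0; ring.
  have K0 : 0 <= K by have := hK 1; rewrite normr1 mulr1; apply: le_trans.
  rewrite -[chi s]subr0 -chi0.
  apply: (@le_trans _ _ ((2 * K) * s)); last by rewrite ler_piMr// mulr_ge0.
  apply: (mvt_bound s0 dchi) => t /andP[t0 ts].
  have := hK t; have := hK (- t); rewrite normrN (ger0_norm t0).
  have t1 : t <= 1 by exact: le_trans ts s1.
  have Kt : K * t <= K by rewrite ler_piMr.
  rewrite !ler_norml => /andP[? ?] /andP[? ?]; apply/andP; split; lra.
move: H; rewrite /psi mulr1 oppr0 expr1n expr0n/= mul1r mul0r subr0.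
rewrite !ler_norml => /andP[? ?]; apply/andP; split; lra.
Qed.

Variables (lam v : R).
Hypothesis lam0 : 0 <= lam.

(** A decreasing logistic step at [v] of steepness [lam]. Its derivative is a polynomial in [sg]
    itself, which makes all derivative bounds uniform. *)
Definition sg (s : R) : R := (1 + expR (lam * (s - v)))^-1.

Lemma sg_gt0 s : 0 < sg s.
Proof. by rewrite invr_gt0 ltr_pwDl// expR_ge0. Qed.

Lemma sg_le1 s : sg s <= 1.
Proof. by rewrite invf_le1 ?ltr_pwDl ?expR_ge0// lerDl expR_ge0. Qed.

Lemma sg_derive (s : R) : is_derive s 1 sg (- (lam * (sg s * (1 - sg s)))).
Proof.
have e0 : 1 + expR (lam * (s - v)) != 0 by rewrite gt_eqF// ltr_pwDl// expR_ge0.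
have d1 : is_derive s 1 (fun s => lam * (s - v)) lam.
  by apply: is_derive_eq; rewrite /GRing.scale/= subr0 mulr1.
have d2 : is_derive s 1 (fun s => expR (lam * (s - v))) (expR (lam * (s - v)) * lam).
  exact: (@is_derive1_comp _ expR (fun s => lam * (s - v))).
have d3 : is_derive s 1 (fun s => 1 + expR (lam * (s - v))) (expR (lam * (s - v)) * lam).
  by have := is_deriveD (is_derive_cst (1:R) s 1) d2; move=> /is_derive_eq; apply; rewrite add0r.
have := @is_deriveV _ (fun s => 1 + expR (lam * (s - v))) s _ _ e0 d3; move=> /is_derive_eq; apply.
by rewrite /sg /GRing.scale/=; field.
Qed.

Lemma sg_lip s t : `|sg (s + t) - sg s| <= lam * `|t|.
Proof.
wlog t0 : s t / 0 <= t.
  move=> W; have [/W//|t0] := leP 0 t.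
  have := W (s + t) (- t); rewrite addrK normrN distrC; apply.
  by rewrite oppr_ge0 ltW.
have d (u : R) : is_derive u 1 (fun u => sg (s + u))
    (- (lam * (sg (s + u) * (1 - sg (s + u))))).
  have d1 : is_derive u 1 (fun u => s + u) 1.
    by have := is_deriveD (is_derive_cst (s : R) u 1) (is_derive_id u 1); move=> /is_derive_eq; apply; rewrite add0r.
  have := @is_derive1_comp _ sg (fun u => s + u) u _ _ (sg_derive (s + u)) d1.
  by move=> /is_derive_eq; apply; rewrite mulr1.
have := mvt_bound t0 d; rewrite addr0 (ger0_norm t0); apply => u _.
rewrite normrN normrM (ger0_norm lam0) ler_piMr//.
have := sg_gt0 (s + u); have := sg_le1 (s + u); set y := sg _ => y1 y0.
rewrite ler_norml; apply/andP; split; nra.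
Qed.

Variable n : nat.
Local Notation V := 'rV[R]_n.
Implicit Types x a b : V.

(* A smooth surrogate of the indicator of {max_j x_j <= v}.  Its mixed second
   derivatives lam^2 sgp (1 - sg x_i) (1 - sg x_j) are nonnegative, which is what
   Slepian's comparison uses. *)
Definition sgp x : R := \prod_j sg (x ord0 j).

(** Along the direction [a], the logarithmic derivative of [sgp] is [- lam * sgA] and the derivative
    of [sgA] is [lam * sgB]; hence the second derivative [sgD]. *)
Definition sgA x a : R := \sum_j a ord0 j * (1 - sg (x ord0 j)).

Definition sgB x a : R :=
  \sum_j a ord0 j ^+ 2 * (sg (x ord0 j) * (1 - sg (x ord0 j))).

Definition sgD x a : R := lam ^+ 2 * sgp x * (sgA x a ^+ 2 - sgB x a).

Lemma sg_line_derive x a j (s : R) :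
  is_derive s 1 (fun s => sg ((x + s *: a) ord0 j))
    (- (lam * a ord0 j * (sg ((x + s *: a) ord0 j) * (1 - sg ((x + s *: a) ord0 j))))).
Proof.
pose u (s : R) := x ord0 j + s * a ord0 j.
have E : (fun s : R => sg ((x + s *: a) ord0 j)) = sg \o u.
  by apply/funext => w; rewrite /= !mxE.
have d1 : is_derive s 1 u (a ord0 j).
  by apply: is_derive_eq; rewrite /GRing.scale/=; ring.
rewrite E.
have := @is_derive1_comp _ sg u s _ _ (sg_derive (u s)) d1.
by move=> /is_derive_eq; apply; rewrite !mxE -/(u s); ring.
Qed.

Lemma sgp_line_derive x a (s : R) :
  is_derive s 1 (fun s => sgp (x + s *: a))
    (- (lam * (sgp (x + s *: a) * sgA (x + s *: a) a))).
Proof.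
rewrite /sgp /sgA; elim: (index_enum _) => [|j r IH].
  rewrite !big_nil mulr0 mulr0 oppr0.
  rewrite (_ : (fun _ => _) = cst 1); first exact: is_derive_cst.
  by apply/funext => w; rewrite big_nil.
rewrite (_ : (fun _ => _) = (fun s => sg ((x + s *: a) ord0 j)) \*
   (fun s => \prod_(i <- r) sg ((x + s *: a) ord0 i))); last first.
  by apply/funext => w; rewrite big_cons.
have d1 := sg_line_derive x a j s.
have := is_deriveM d1 IH; move=> /is_derive_eq; apply.
by rewrite /GRing.scale/= !big_cons; ring.
Qed.

Lemma sgA_line_derive x a (s : R) :
  is_derive s 1 (fun s => sgA (x + s *: a) a) (lam * sgB (x + s *: a) a).
Proof.
rewrite /sgB /sgA; elim: (index_enum _) => [|j r IH].
  rewrite !big_nil mulr0.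
  rewrite (_ : (fun _ => _) = cst 0); first exact: is_derive_cst.
  by apply/funext => w; rewrite big_nil.
rewrite (_ : (fun _ => _) = (fun s => a ord0 j * (1 - sg ((x + s *: a) ord0 j))) +
   (fun s => \sum_(i <- r) a ord0 i * (1 - sg ((x + s *: a) ord0 i)))); last first.
  by apply/funext => w; rewrite big_cons.
have d1 := sg_line_derive x a j s.
have d2 : is_derive s 1 (fun s => a ord0 j * (1 - sg ((x + s *: a) ord0 j)))
   (lam * (a ord0 j ^+ 2 * (sg ((x + s *: a) ord0 j) * (1 - sg ((x + s *: a) ord0 j))))).
  by apply: is_derive_eq; rewrite /GRing.scale/=; ring.
have := is_deriveD d2 IH; move=> /is_derive_eq; apply.
by rewrite !big_cons; ring.
Qed.

Lemma sgp_line_derive2 x a (s : R) :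
  is_derive s 1 (fun s => - (lam * (sgp (x + s *: a) * sgA (x + s *: a) a)))
    (sgD (x + s *: a) a).
Proof.
have d1 := sgp_line_derive x a s; have d2 := sgA_line_derive x a s.
by apply: is_derive_eq; rewrite /sgD /GRing.scale/=; ring.
Qed.

Lemma sgp01 x : 0 <= sgp x <= 1.
Proof.
apply/andP; split; first by apply: prodr_ge0 => j _; exact/ltW/sg_gt0.
by apply: prodr_ile1 => j; rewrite ltW ?sg_gt0// sg_le1.
Qed.

Lemma sgA_le x a : `|sgA x a| <= nm1 a.
Proof.
apply: le_trans (ler_norm_sum _ _ _) _; apply: ler_sum => j _.
rewrite normrM ler_piMr// ger0_norm ?subr_ge0 ?sg_le1//.
by rewrite gerBl ltW// sg_gt0.
Qed.

Lemma sum_sqr_le a : \sum_j a ord0 j ^+ 2 <= nm1 a ^+ 2.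
Proof.
rewrite /nm1; elim: (index_enum _) => [|j r IH]; first by rewrite !big_nil expr0n.
rewrite !big_cons sqrrD real_normK ?num_real//.
have : 0 <= `|a ord0 j| * \sum_(i <- r) `|a ord0 i| by rewrite mulr_ge0// sumr_ge0.
move: IH; set s1 := \sum_(i <- r) _; set s2 := \sum_(i <- r) _; lra.
Qed.

Lemma sgB_bnd x a : 0 <= sgB x a <= nm1 a ^+ 2.
Proof.
apply/andP; split.
  apply: sumr_ge0 => j _; apply: mulr_ge0; first exact: sqr_ge0.
  by rewrite mulr_ge0 ?subr_ge0 ?sg_le1// ltW ?sg_gt0.
apply: le_trans (sum_sqr_le a); apply: ler_sum => j _; rewrite ler_piMr ?sqr_ge0//.
have := sg_gt0 (x ord0 j); have := sg_le1 (x ord0 j); set y := sg _ => y1 y0; nra.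
Qed.

Lemma sgp_tame : tame lam sgp.
Proof.
split; first exact: sgp01.
move=> x a; have := @mvt_bound _ _ _ (lam * nm1 a) (@ler01 R) (sgp_line_derive x a).
rewrite scale1r scale0r addr0 mulr1; apply => s _.
rewrite normrN normrM (ger0_norm lam0) ler_wpM2l// normrM.
have /andP[p0 p1] := sgp01 (x + s *: a).
by rewrite (ger0_norm p0) (le_trans _ (sgA_le (x + s *: a) a))// ler_piMl.
Qed.

Lemma norm_coord_le a j : `|a ord0 j| <= nm1 a.
Proof. by rewrite /nm1 (bigD1 j)//= lerDl sumr_ge0. Qed.

Lemma sg_coord_lip x a j : `|sg ((x + a) ord0 j) - sg (x ord0 j)| <= lam * nm1 a.
Proof.
rewrite mxE; apply: le_trans (sg_lip _ _) _.
by rewrite ler_wpM2l// norm_coord_le.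
Qed.

Lemma sgA_lip x a b : `|sgA (x + a) b - sgA x b| <= lam * nm1 a * nm1 b.
Proof.
rewrite -sumrB (le_trans (ler_norm_sum _ _ _))// [leRHS]mulr_sumr.
apply: ler_sum => j _; rewrite -mulrBr normrM mulrC ler_wpM2r//.
have -> : 1 - sg ((x + a) ord0 j) - (1 - sg (x ord0 j)) =
  - (sg ((x + a) ord0 j) - sg (x ord0 j)) by ring.
by rewrite normrN sg_coord_lip.
Qed.

Lemma sgB_lip x a b : `|sgB (x + a) b - sgB x b| <= lam * nm1 a * nm1 b ^+ 2.
Proof.
rewrite -sumrB (le_trans (ler_norm_sum _ _ _))//.
have l0 : 0 <= lam * nm1 a by rewrite mulr_ge0// nm1_ge0.
apply: le_trans (ler_wpM2l l0 (sum_sqr_le b)); rewrite [leRHS]mulr_sumr.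
apply: ler_sum => j _; rewrite -mulrBr normrM mulrC normrX real_normK ?num_real//.
rewrite ler_wpM2r ?sqr_ge0//.
have := sg_coord_lip x a j; have := sg_gt0 (x ord0 j); have := sg_le1 (x ord0 j).
have := sg_gt0 ((x + a) ord0 j); have := sg_le1 ((x + a) ord0 j).
set y := sg _; set w := sg _ => y1 y0 w1 w0.
have -> : y * (1 - y) - w * (1 - w) = (y - w) * (1 - y - w) by ring.
move=> H; rewrite normrM (le_trans _ H)// ler_piMr//.
by rewrite ler_norml; apply/andP; split; lra.
Qed.

(** The increment of [sgD] splits into those of [sgA], [sgB] and [sgp], which contribute 2, 1 and 2
    to the constant 5. The Taylor bound then follows from this Lipschitz bound by
    [second_difference]. *)
Lemma sgp_smooth2 : smooth2 (5 * lam ^+ 3) sgp sgD.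
Proof.
have DD x a b : `|sgD (x + a) b - sgD x b| <= 5 * lam ^+ 3 * (nm1 a * nm1 b ^+ 2).
  rewrite /sgD -!(mulrA (lam ^+ 2)) -mulrBr normrM (ger0_norm (sqr_ge0 _)).
  rewrite [leRHS](_ : _ = lam ^+ 2 * (5 * (lam * nm1 a * nm1 b ^+ 2))); last by ring.
  rewrite ler_wpM2l ?sqr_ge0//.
  have /andP[p0 p1] := sgp01 x; have /andP[p0' p1'] := sgp01 (x + a).
  have [_ /(_ x a)] := sgp_tame; have := sgA_lip x a b; have := sgB_lip x a b.
  have := sgA_le x b; have := sgA_le (x + a) b; have := sgB_bnd x b.
  have := nm1_ge0 a; have := nm1_ge0 b.
  set f := sgp x; set f' := sgp (x + a); set A := sgA x b; set A' := sgA (x + a) b.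
  set B := sgB x b; set B' := sgB (x + a) b; set N := nm1 b; set M := nm1 a.
  move=> N0 M0 /andP[B0 BN] A'N AN BB AA ff.
  have E1 : f' * (A' ^+ 2 - B') - f * (A ^+ 2 - B) =
    f' * ((A' - A) * (A' + A)) - f' * (B' - B) + (f' - f) * (A ^+ 2 - B) by ring.
  have lM0 : 0 <= lam * M by rewrite mulr_ge0.
  have T1 : `|f' * ((A' - A) * (A' + A))| <= (lam * M * N) * (2 * N).
    rewrite normrM (ger0_norm p0'); apply: le_trans (_ : `|(A' - A) * (A' + A)| <= _).
      by rewrite ler_piMl.
    rewrite normrM ler_pM// (le_trans (ler_normD _ _))//; lra.
  have T2 : `|f' * (B' - B)| <= lam * M * N ^+ 2.
    rewrite normrM (ger0_norm p0'); apply: le_trans (_ : `|B' - B| <= _) => //.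
    by rewrite ler_piMl.
  have T3 : `|(f' - f) * (A ^+ 2 - B)| <= (lam * M) * (2 * N ^+ 2).
    rewrite normrM ler_pM//.
    have AN2 : A ^+ 2 <= N ^+ 2 by rewrite -[A ^+ 2]real_normK ?num_real// lerXn2r// nnegrE.
    have A20 := sqr_ge0 A.
    by rewrite ler_norml; apply/andP; split; lra.
  rewrite E1; apply: le_trans (ler_normD _ _) _.
  have := ler_normB (f' * ((A' - A) * (A' + A))) (f' * (B' - B)).
  have -> : 5 * (lam * M * N ^+ 2) = lam * M * N * (2 * N) + lam * M * N ^+ 2 + lam * M * (2 * N ^+ 2) by ring.
  lra.
split=> //.
- by rewrite mulr_ge0// exprn_ge0.
- move=> x a.
  have := @second_difference _ _ (fun s => sgD (x + s *: a) a) (5 * lam ^+ 3 * nm1 a ^+ 3)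
    (sgp_line_derive x a) (sgp_line_derive2 x a).
  rewrite scale1r scaleN1r scale0r addr0; apply => s.
  apply: le_trans (DD x (s *: a) a) _; rewrite nm1Z.
  by rewrite [leRHS](_ : _ = 5 * lam ^+ 3 * (`|s| * nm1 a * nm1 a ^+ 2))//; ring.
- move=> x c b; rewrite /sgD.
  have -> : sgA x (c *: b) = c * sgA x b.
    by rewrite /sgA mulr_sumr; apply: eq_bigr => j _; rewrite mxE mulrA.
  have -> : sgB x (c *: b) = c ^+ 2 * sgB x b.
    by rewrite /sgB mulr_sumr; apply: eq_bigr => j _; rewrite mxE; ring.
  by ring.
Qed.

(** The covariance matrix of the sum of the vectors of [l] with independent standard normal
    coefficients. *)
Definition gram (l : seq V) i j : R := \sum_(a <- l) a ord0 i * a ord0 j.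

Lemma sum_sgD l x : \sum_(a <- l) sgD x a = lam ^+ 2 * sgp x *
  (\sum_i \sum_j gram l i j * ((1 - sg (x ord0 i)) * (1 - sg (x ord0 j)))
   - \sum_j gram l j j * (sg (x ord0 j) * (1 - sg (x ord0 j)))).
Proof.
rewrite -mulr_sumr; congr (_ * _); rewrite sumrB; congr (_ - _).
  transitivity (\sum_(a <- l) \sum_i \sum_j a ord0 i * a ord0 j *
     ((1 - sg (x ord0 i)) * (1 - sg (x ord0 j)))).
    apply: eq_bigr => a _; rewrite expr2 /sgA mulr_suml; apply: eq_bigr => i _.
    by rewrite mulr_sumr; apply: eq_bigr => j _; ring.
  rewrite exchange_big; apply: eq_bigr => i _; rewrite exchange_big; apply: eq_bigr => j _.
  by rewrite mulr_suml.
rewrite exchange_big; apply: eq_bigr => j _.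
by rewrite mulr_suml; apply: eq_bigr => a _; rewrite expr2.
Qed.

(** In [sum_sgD] the off-diagonal entries of [gram] carry nonnegative weights, while the diagonal
    ones, whose weights have no fixed sign, agree on both sides. *)
Lemma slepian l1 l2 x : (forall j, gram l1 j j = gram l2 j j) ->
  (forall i j, i != j -> gram l1 i j <= gram l2 i j) ->
  gausses l1 sgp x <= gausses l2 sgp x.
Proof.
move=> dg od; apply: (gausses_le _ sgp_tame sgp_smooth2) => y.
rewrite !sum_sgD ler_wpM2l//.
  by rewrite mulr_ge0 ?sqr_ge0//; case/andP: (sgp01 y).
apply: lerB; last by under [leRHS]eq_bigr do rewrite dg.
apply: ler_sum => i _; apply: ler_sum => j _.
have [->|ij] := eqVneq i j; first by rewrite dg.
by rewrite ler_wpM2r ?od// mulr_ge0// subr_ge0 sg_le1.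
Qed.

End logistic.

(** * Gaussian vectors *)

Section quantization.
Variable R : realType.

Lemma normal_probE (A : set R) : measurable A -> fine (normal_prob 0 1 A) = GE (\1_A : R -> R).
Proof.
move=> mA; rewrite /normal_prob /GE /Rintegral; congr fine; rewrite [LHS]integral_mkcond.
apply: eq_integral => z _; rewrite patchE indicE.
by case: ifPn => zA; rewrite ?mul1r ?mul0r.
Qed.

(** The first 2 N^2 cells cover [-N, N[ with mesh 1/N, so that one parameter controls both the mesh
    and the neglected tails. *)
Definition grid (N : nat) (k : nat) : R := - N%:R + k%:R / N%:R.

Definition cell N k : set R := [set` `[grid N k, grid N k.+1[ ].

Definition icell N k (s : R) : R := (grid N k <= s < grid N k.+1)%R%:R.

Lemma icellE N k : icell N k = \1_(cell N k).
Proof.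
apply/funext => s; rewrite indicE /icell /cell; congr (nat_of_bool _)%:R.
apply/idP/idP => [h|/set_mem]; first by apply/mem_set; rewrite /= in_itv.
by rewrite /= in_itv.
Qed.

Lemma icell_measurable N k : measurable_fun setT (icell N k).
Proof. by rewrite icellE; apply: measurable_indic; exact: measurable_itv. Qed.

Lemma icell01 N k s : 0 <= icell N k s <= 1.
Proof. by rewrite /icell; case: (_ <= _ < _); rewrite ?ler01 lexx. Qed.

Lemma sum_icell N r s : \sum_(k < r) icell N k s = (grid N 0 <= s < grid N r)%R%:R.
Proof.
have le_grid k : grid N k <= grid N k.+1.
  by rewrite /grid lerD2l ler_wpM2r ?invr_ge0// ler_nat.
have le0_grid k : grid N 0 <= grid N k.
  by elim: k => // k IH; exact: le_trans IH (le_grid k).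
elim: r => [|r IH]; first by rewrite big_ord0; case: (leP (grid N 0) s) => //= h; rewrite ltNge h.
rewrite big_ord_recr /= IH /icell.
have := le_grid r; have := le0_grid r.
case: (leP (grid N 0) s) => h0; case: (ltP s (grid N r)) => h1 //=;
  case: (ltP s (grid N r.+1)) => h2 //=; rewrite ?addr0 ?add0r//.
- by move=> _ h; have := lt_le_trans h1 h; rewrite ltNge h2.
- by move=> h; have := lt_le_trans h0 (le_trans h h1); rewrite ltxx.
Qed.

(** Inside the cells the Lipschitz bound over one mesh width applies; outside, the sum of the
    [icell] vanishes and G <= 1. *)
Lemma quantize (K : R) N r (G : R -> R) s : (0 < N)%N -> 0 <= K ->
  (forall z, 0 <= G z <= 1) -> (forall z w, `|G (z + w) - G z| <= K * `|w|) ->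
  `|G s - \sum_(k < r) icell N k s * G (grid N k)|
    <= K / N%:R + (1 - \sum_(k < r) icell N k s).
Proof.
move=> N0 K0 G01 GK.
have KN0 : 0 <= K / N%:R by rewrite divr_ge0.
have i0 k : 0 <= icell N k s by case/andP: (icell01 N k s).
have S1 : \sum_(k < r) icell N k s <= 1 by rewrite sum_icell; case: (_ && _); rewrite ?ler01.
have -> : G s - \sum_(k < r) icell N k s * G (grid N k) =
  G s * (1 - \sum_(k < r) icell N k s) +
  \sum_(k < r) icell N k s * (G s - G (grid N k)).
  have -> : \sum_(k < r) icell N k s * (G s - G (grid N k)) =
      (\sum_(k < r) icell N k s) * G s - \sum_(k < r) icell N k s * G (grid N k).
    by rewrite mulr_suml -sumrB; apply: eq_bigr => k _; rewrite mulrBr.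
  by ring.
have /andP[g0 g1] := G01 s.
apply: le_trans (ler_normD _ _) _; rewrite addrC; apply: lerD; last first.
  by rewrite normrM (ger0_norm g0) ger0_norm ?subr_ge0// ler_piMl// subr_ge0.
apply: le_trans (ler_norm_sum _ _ _) _.
apply: le_trans (_ : \sum_(k < r) icell N k s * (K / N%:R) <= _); last first.
  by rewrite -mulr_suml ler_piMl.
apply: ler_sum => k _; rewrite normrM (ger0_norm (i0 _)) /icell.
case: (boolP (_ <= _ < _)) => [/andP[h1 h2]|_]; last by rewrite !mul0r.
rewrite !mul1r -[s in G s](subrKC (grid N k)).
apply: le_trans (GK _ _) _; rewrite ler_wpM2l// ger0_norm ?subr_ge0//.
rewrite lerBlDr; apply: le_trans (ltW h2) _.
by rewrite /grid -natr1 mulrDl mul1r; lra.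
Qed.

Definition qerr N : R := GE (fun s : R => 1 - \sum_(k < (2 * (N * N))%N) icell N k s).

Lemma Gint_icell N k : Gint (icell N k).
Proof.
apply: (@Gint_bounded _ _ 1); first exact: icell_measurable.
by move=> z; have /andP[? ?] := icell01 N k z; rewrite ger0_norm.
Qed.

Lemma Gint_qerr N r : Gint (fun s : R => 1 - \sum_(k < r) icell N k s).
Proof.
have [i _] := GE_sum r (fun k => Gint_icell N k).
have := GintD (Gint_cst (1:R)) (GintZ (-1) i).
by rewrite (_ : (fun z => _ + _) = (fun s => 1 - \sum_(k < r) icell N k s))//;
  apply/funext => z; rewrite mulN1r.
Qed.

(** Markov's inequality with the third moment: outside [-N, N[ one has N <= |z| <= |z|^3. *)
Lemma qerr_le N : (0 < N)%N -> qerr N <= gmom3 R / N%:R.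
Proof.
move=> N0; have N0' : 0 < N%:R :> R by rewrite ltr0n.
have N1 : 1 <= N%:R :> R by rewrite ler1n.
rewrite mulrC /gmom3 -GEZ; last exact: Gint_norm3.
apply: GE_le; [exact: Gint_qerr|apply: GintZ; exact: Gint_norm3|].
move=> z; rewrite sum_icell.
have g0 : grid N 0 = - N%:R by rewrite /grid mul0r addr0.
have g1 : grid N (2 * (N * N)) = N%:R.
  by rewrite /grid !natrM mulrA mulfK ?gt_eqF//; lra.
rewrite g0 g1; case: (boolP (_ && _)) => [_|h].
  by rewrite subrr mulr_ge0 ?invr_ge0 ?exprn_ge0// ltW.
rewrite subr0 ler_pdivlMl// mulr1.
have : N%:R <= `|z|.
  move: h; rewrite negb_and -ltNge -leNgt => /orP[h|h].
    by rewrite ltr0_norm; lra.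
  by rewrite (le_trans h)// ler_norm.
move=> {}h; apply: (le_trans h); set y := `|z|.
have y1 : 1 <= y by exact: le_trans N1 h.
by rewrite -[leLHS]expr1 ler_weXn2l.
Qed.

End quantization.

(** * From independent coordinates to smoothing operators *)

Section gaussian_vector.
Variables (R : realType) (d : measure_display) (T : measurableType d)
  (P : probability T R).
Implicit Types (F G e : T -> R) (M : R).

Definition PE (F : T -> R) : R := \int[P]_w F w.

Definition Pint (F : T -> R) : Prop := P.-integrable setT (EFin \o F).

Lemma Pint_bounded F M : measurable_fun setT F -> (forall w, `|F w| <= M) -> Pint F.
Proof.
move=> mF FM; apply: (@le_integrable _ _ _ _ _ measurableT _ (EFin \o cst M)).
- exact/measurable_EFinP.
- move=> w _ /=; rewrite lee_fin; exact: le_trans (FM w) (ler_norm _).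
- exact: finite_measure_integrable_cst.
Qed.

Lemma PintD F G : Pint F -> Pint G -> Pint (fun w => F w + G w).
Proof. by move=> iF iG; have := integrableD measurableT iF iG. Qed.

Lemma PintB F G : Pint F -> Pint G -> Pint (fun w => F w - G w).
Proof. by move=> iF iG; have := integrableB measurableT iF iG. Qed.

Lemma Pint_cst M : Pint (cst M).
Proof. exact: finite_measure_integrable_cst. Qed.

Lemma PE_cst M : PE (cst M) = M.
Proof.
by rewrite /PE Rintegral_cst// [X in fine X](_ : _ = 1%E) ?mulr1//; exact: probability_setT.
Qed.

Lemma PED F G : Pint F -> Pint G -> PE (fun w => F w + G w) = PE F + PE G.
Proof. by move=> iF iG; rewrite /PE RintegralD. Qed.

Lemma PEB F G : Pint F -> Pint G -> PE (fun w => F w - G w) = PE F - PE G.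
Proof. by move=> iF iG; rewrite /PE RintegralB. Qed.

Lemma PE_le F G : Pint F -> Pint G -> (forall z, F z <= G z) -> PE F <= PE G.
Proof. by move=> iF iG FG; apply: le_Rintegral. Qed.

Lemma PE_dist F G e : Pint F -> Pint G -> Pint e ->
  (forall z, `|F z - G z| <= e z) -> `|PE F - PE G| <= PE e.
Proof.
move=> iF iG ie FG; rewrite /PE -RintegralB//.
have iFG := PintB iF iG.
apply: le_trans (le_normr_Rintegral measurableT iFG) _.
apply: le_Rintegral => //.
exact: integrable_norm iFG.
Qed.

Lemma PE_sum (r : nat) (F : nat -> T -> R) : (forall i, Pint (F i)) ->
  Pint (fun z => \sum_(i < r) F i z) /\
  PE (fun z => \sum_(i < r) F i z) = \sum_(i < r) PE (F i).
Proof.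
move=> iF; elim: r => [|r [ir IH]].
  have E : (fun z => \sum_(i < 0) F i z) = cst 0 by apply/funext => z; rewrite big_ord0.
  by rewrite big_ord0 E; split; [exact: Pint_cst|exact: PE_cst].
have E : (fun z => \sum_(i < r.+1) F i z) = (fun z => \sum_(i < r) F i z + F r z).
  by apply/funext => z; rewrite big_ord_recr.
rewrite E; split; first exact: PintD.
by rewrite PED// IH big_ord_recr.
Qed.

Lemma PE_indic (A : set T) : measurable A -> PE (\1_A : T -> R) = fine (P A).
Proof. by move=> mA; rewrite /PE /Rintegral integral_indic// setIT. Qed.

Lemma fineP_ge0 (A : set T) : 0 <= fine (P A).
Proof. exact: fine_ge0. Qed.

Lemma fineP_le1 (A : set T) : measurable A -> fine (P A) <= 1.
Proof.
move=> mA; rewrite -lee_fin fineK ?fin_num_measure//; exact: probability_le1.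
Qed.

Variables (p : nat) (xi : 'I_p -> {RV P >-> R}).
Hypothesis hxi : standard_gaussian xi.

Definition rect (J : {set 'I_p}) (B : 'I_p -> set R) : set T :=
  \big[setI/setT]_(i in J) (xi i @^-1` B i).

Implicit Types (J : {set 'I_p}) (B : 'I_p -> set R) (A : set R).

Lemma rect_measurable J B : (forall i, measurable (B i)) -> measurable (rect J B).
Proof.
move=> mB; rewrite /rect; elim/big_ind: _ => // [A A' mA mA'|i _].
  exact: measurableI.
by rewrite -[_ @^-1` _]setTI; exact: measurable_funP.
Qed.

Lemma rect_setU1 i J B A : i \notin J ->
  rect (i |: J)%SET (fun j => if j == i then A else B j) =
  (xi i @^-1` A) `&` rect J B.
Proof.
move=> iJ; rewrite /rect big_setU1//= eqxx; congr (_ `&` _).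
by apply: eq_bigr => j jJ; case: eqVneq => // ji; rewrite -ji jJ in iJ.
Qed.

Lemma rect_setU1_prob i J B A : i \notin J -> measurable A -> (forall i, measurable (B i)) ->
  fine (P ((xi i @^-1` A) `&` rect J B)) = GE (\1_A : R -> R) * fine (P (rect J B)).
Proof.
move=> iJ mA mB; case: hxi => law ind.
rewrite -rect_setU1// /rect ind; last by move=> j; case: ifP.
rewrite big_setU1//= eqxx fineM//.
- congr (_ * _); first by rewrite -normal_probE// -(law i)//.
  rewrite ind//; congr fine; apply: eq_bigr => j jJ.
  by case: eqVneq => // ji; rewrite -ji jJ in iJ.
- by rewrite fin_num_measure// -[_ @^-1` _]setTI; exact: measurable_funP.
- apply/prode_fin_num => j _; rewrite fin_num_measure// -[_ @^-1` _]setTI.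
  by case: ifP => _; exact: measurable_funP.
Qed.

Variables (n : nat) (f : 'rV[R]_n -> R) (L : R) (a : 'I_p -> 'rV[R]_n).
Hypothesis tf : tame L f.
Hypothesis mf : forall h : 'I_n -> T -> R, (forall j, measurable_fun setT (h j)) ->
  measurable_fun setT (fun w => f (\row_j h j w)).

Lemma comb_measurable s x :
  measurable_fun setT (fun w => f (x + \sum_(i <- s) xi i w *: a i)).
Proof.
rewrite (_ : (fun _ => _) = (fun w => f (\row_j (x ord0 j + \sum_(i <- s) xi i w * a i ord0 j)))).
  apply: mf => j; apply: measurable_funD => //.
  by apply: measurable_sum => i; apply: measurable_funM => //; exact: measurable_funP.
apply/funext => w; congr f; apply/rowP => j; rewrite !mxE summxE; congr (_ + _).
by apply: eq_bigr => i _; rewrite mxE.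
Qed.

(* The event rect J B absorbs the coordinate being quantized, so that the
   product rule over rectangles is all that is used of independence. *)
Lemma indep_gausses s J B x : uniq s -> (forall i, i \in s -> i \notin J) ->
  (forall i, measurable (B i)) ->
  PE (fun w => \1_(rect J B) w * f (x + \sum_(i <- s) xi i w *: a i)) =
  fine (P (rect J B)) * gausses (map a s) f x.
Proof.
elim: s J B x => [|i s IH] J B x.
  move=> _ _ mB; rewrite -PE_indic; last exact: rect_measurable.
  rewrite /PE -RintegralZr//; last first.
    apply: (@Pint_bounded _ 1).
      by apply: measurable_indic; exact: rect_measurable.
    by move=> w; rewrite indicE; case: (_ \in _); rewrite ?normr1 ?normr0.
  by apply: eq_Rintegral => w _; rewrite big_nil addr0.
rewrite cons_uniq => /andP[iNs us] sJ mB.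
have iJ : i \notin J by apply: sJ; rewrite mem_head.
set E := rect J B.
have mE : measurable E := rect_measurable J mB.
have f01 y : 0 <= f y <= 1 by case: tf.
have L0 : 0 <= `|L| * nm1 (a i) by rewrite mulr_ge0// nm1_ge0.
set K := `|L| * nm1 (a i) in L0 *.
pose F z w := f (x + z *: a i + \sum_(i <- s) xi i w *: a i).
pose G z := gausses (map a s) f (x + z *: a i).
have lipK (g : 'rV[R]_n -> R) : tame L g -> forall y z u,
    `|g (y + (z + u) *: a i) - g (y + z *: a i)| <= K * `|u|.
  move=> [_ gL] y z u; rewrite scalerDl addrA; apply: le_trans (gL _ _) _.
  rewrite nm1Z mulrCA mulrC ler_wpM2r// ler_wpM2r ?nm1_ge0//; exact: ler_norm.
have i01 (A : set T) w : 0 <= (\1_A w : R) <= 1.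
  by rewrite indicE; case: (_ \in _); rewrite ?ler01 lexx.
have bF (A : set T) z : measurable A -> Pint (fun w => \1_A w * F z w).
  move=> mA; apply: (@Pint_bounded _ 1).
    by apply: measurable_funM => //; exact: comb_measurable.
  move=> w; have /andP[? ?] := i01 A w; have /andP[? ?] := f01 (x + z *: a i + \sum_(i <- s) xi i w *: a i).
  by rewrite ger0_norm ?mulr_ge0// mulr_ile1.
have LHSE : (fun w => \1_E w * f (x + \sum_(j <- i :: s) xi j w *: a j)) =
   fun w => \1_E w * F (xi i w) w.
  by apply/funext => w; rewrite big_cons /F addrA.
have iL : Pint (fun w => \1_E w * F (xi i w) w).
  rewrite -LHSE; apply: (@Pint_bounded _ 1).
    by apply: measurable_funM => //; exact: comb_measurable.
  move=> w; have /andP[? ?] := i01 E w; have /andP[? ?] := f01 (x + \sum_(j <- i :: s) xi j w *: a j).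
  by rewrite ger0_norm ?mulr_ge0// mulr_ile1.
rewrite LHSE [gausses _ _ _]/= -/(gausses (map a s) f) /gauss -/(GE G).
have tG : tame L (gausses (map a s) f) := tame_gausses _ tf.
have iG : Gint G by exact: tame_Gint tG.
have mxi (A : set R) : measurable A -> measurable (xi i @^-1` A).
  by move=> mA; rewrite -[_ @^-1` _]setTI; exact: measurable_funP.
(* Both terms lie within (K + gmom3) / N of the same sum [Q], where the coordinate [i] is replaced
   by the left end of its cell. *)
have key N : (0 < N)%N -> `|PE (fun w => \1_E w * F (xi i w) w) - fine (P E) * GE G|
   <= 2 * (K + gmom3 R) / N%:R.
  move=> N0; set r := (2 * (N * N))%N.
  pose Q := \sum_(k < r) fine (P ((xi i @^-1` cell N k) `&` E)) * G (grid R N k).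
  have mc k : measurable (cell N k : set R) by exact: measurable_itv.
  have icE k w : icell N k (xi i w) = \1_(xi i @^-1` cell N k) w.
    by rewrite icellE /= !indicE; congr (nat_of_bool _)%:R; apply/idP/idP; rewrite !inE.
  have micell k : measurable_fun setT (fun w => icell N k (xi i w)).
    by apply: measurableT_comp; [exact: icell_measurable|exact: measurable_funP].
  have Pic k : PE (fun w => icell N k (xi i w)) = GE (icell N k).
    transitivity (fine (P (xi i @^-1` cell N k))).
      rewrite -PE_indic; last exact: (mxi _ (mc k)).
      by apply: eq_Rintegral => w _; rewrite icE.
    case: hxi => law _; have := law i (cell N k) (mc k); rewrite /distribution /pushforward => ->.
    by rewrite normal_probE// icellE.
  have iic k : Pint (fun w => icell N k (xi i w)).
    apply: (@Pint_bounded _ 1) => // w.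
    by have /andP[? ?] := icell01 N k (xi i w); rewrite ger0_norm.
  have [isum Psum] := PE_sum r iic.
  have [isumG Gsum] := GE_sum r (fun k => Gint_icell R N k).
  have qE : PE (fun w => K / N%:R + (1 - \sum_(k < r) icell N k (xi i w))) = K / N%:R + qerr R N.
    rewrite PED; [|exact: Pint_cst|by apply: PintB => //; exact: Pint_cst].
    rewrite PE_cst PEB//; last exact: Pint_cst.
    rewrite PE_cst Psum.
    rewrite /qerr -/r; have -> : (fun s0 => 1 - \sum_(k < r) icell N k s0) =
        (fun s0 => (cst 1 s0 : R) - \sum_(k < r) icell N k s0) by [].
    rewrite GEB//; last exact: Gint_cst.
    by rewrite GE_cst Gsum; under eq_bigr do rewrite Pic.
  have qN : K / N%:R + qerr R N <= (K + gmom3 R) / N%:R.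
    by rewrite mulrDl lerD2l qerr_le.
  have H1 : `|PE (fun w => \1_E w * F (xi i w) w) - Q| <= K / N%:R + qerr R N.
    have iterm k : Pint (fun w => \1_((xi i @^-1` cell N k) `&` E) w * F (grid R N k) w).
      by apply: bF; apply: measurableI => //; exact: (mxi _ (mc k)).
    have [iS PS] := PE_sum r iterm.
    have -> : Q = PE (fun w => \sum_(k < r) \1_((xi i @^-1` cell N k) `&` E) w * F (grid R N k) w).
      rewrite PS; apply: eq_bigr => k _.
      (* The cell of the coordinate [i] joins the rectangle, and the induction hypothesis is used at
         the shifted base point [x + grid R N k *: a i]. *)
      rewrite -(rect_setU1 B (cell N k) iJ) -IH//.
      - move=> j js; rewrite in_setU1 negb_or sJ ?in_cons ?js ?orbT// andbT.
        by apply: contraNneq iNs => <-.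
      - by move=> j; case: ifP => // _; exact: measurable_itv.
    rewrite -qE; apply: PE_dist => //.
      by apply: PintD; [exact: Pint_cst|apply: PintB => //; exact: Pint_cst].
    move=> w.
    have -> : \sum_(k < r) \1_((xi i @^-1` cell N k) `&` E) w * F (grid R N k) w =
      \1_E w * \sum_(k < r) icell N k (xi i w) * F (grid R N k) w.
      rewrite mulr_sumr; apply: eq_bigr => k _; rewrite icE indicI /=; ring.
    rewrite -mulrBr normrM; have /andP[e0 e1] := i01 E w.
    rewrite (ger0_norm e0); apply: le_trans (_ : `|F (xi i w) w - \sum_(k < r) icell N k (xi i w) * F (grid R N k) w| <= _).
      by rewrite ler_piMl.
    apply: (@quantize _ K N r (F ^~ w) (xi i w)) => // [z|z u]; first exact: f01.
    rewrite /F (addrAC x ((z + u) *: a i)) (addrAC x (z *: a i)); exact: lipK.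
  have H2 : `|fine (P E) * GE G - Q| <= K / N%:R + qerr R N.
    have -> : Q = fine (P E) * GE (fun z => \sum_(k < r) icell N k z * G (grid R N k)).
      have iterm k : Gint (fun z => icell N k z * G (grid R N k)).
        have := GintZ (G (grid R N k)) (Gint_icell R N k).
        by congr (Gint _); apply/funext => z; rewrite mulrC.
      have [_ ->] := GE_sum r iterm; rewrite mulr_sumr; apply: eq_bigr => k _.
      rewrite rect_setU1_prob//.
      rewrite -icellE -/E.
      have -> : GE (fun z => icell N k z * G (grid R N k)) = G (grid R N k) * GE (icell N k).
        by rewrite -GEZ; [apply: GE_eq => z; rewrite mulrC|exact: Gint_icell].
      by ring.
    rewrite -mulrBr normrM (ger0_norm (fineP_ge0 _)).
    apply: le_trans (_ : `|GE G - GE (fun z => \sum_(k < r) icell N k z * G (grid R N k))| <= _).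
      by rewrite ler_piMl// fineP_le1.
    have iq := Gint_qerr R N r.
    rewrite -[K / N%:R]GE_cst /qerr -/r -GED//; last exact: Gint_cst.
    have iterm k : Gint (fun z => icell N k z * G (grid R N k)).
      have := GintZ (G (grid R N k)) (Gint_icell R N k).
      by congr (Gint _); apply/funext => z; rewrite mulrC.
    apply: GE_dist => //; first by case: (GE_sum r iterm).
      by apply: GintD => //; exact: Gint_cst.
    move=> z; apply: (@quantize _ K N r G z) => // [u|u v]; first by case: tG => h _; exact: h.
    exact: lipK.
  have := le_trans H1 qN; have := le_trans H2 qN.
  have -> : 2 * (K + gmom3 R) / N%:R = (K + gmom3 R) / N%:R + (K + gmom3 R) / N%:R by ring.
  rewrite !ler_norml => /andP[? ?] /andP[? ?]; apply/andP; split; lra.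
apply/eqP; rewrite -subr_eq0 -normr_le0.
set D := `|_|; rewrite leNgt; apply/negP => D0.
set C := 2 * (K + gmom3 R).
have C0 : 0 <= C by rewrite mulr_ge0// addr_ge0// gmom3_ge0.
have [N CN] : exists N : nat, C / D < N%:R.
  by exists (Num.truncn (C / D)).+1; exact: truncnS_gt.
have N0 : (0 < N)%N.
  by rewrite -(ltr0n R); apply: le_lt_trans CN; rewrite divr_ge0// ltW.
have := key N N0; rewrite -/C -/D ler_pdivlMr ?ltr0n// leNgt mulrC -ltr_pdivrMr//.
by rewrite CN.
Qed.

Lemma expectation_gausses x :
  PE (fun w => f (x + \sum_i xi i w *: a i)) = gausses (map a (index_enum 'I_p)) f x.
Proof.
have := @indep_gausses (index_enum 'I_p) finset.set0 (fun=> setT) x (index_enum_uniq _) _ _.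
rewrite /rect big_set0 indicT probability_setT /= mul1r => <-//.
  by apply: eq_Rintegral => w _; rewrite mul1r.
by move=> i _; rewrite inE.
Qed.

End gaussian_vector.

(** * Normal tails *)

Section normal_tail.
Variable R : realType.
Local Notation mu := (@lebesgue_measure R).

Lemma Gint_indic (A : set R) : measurable A -> Gint (\1_A : R -> R).
Proof.
move=> mA; apply: (@Gint_bounded _ _ 1); first exact: measurable_indic.
by move=> z; rewrite indicE; case: (_ \in _); rewrite ?normr1 ?normr0.
Qed.

Lemma GE_indic (A : set R) : measurable A ->
  GE (\1_A : R -> R) = fine (\int[mu]_(x in A) (phi x)%:E)%E.
Proof. by move=> mA; rewrite -normal_probE. Qed.

Lemma phi_cvg : phi x @[x --> +oo%R] --> (0 : R).
Proof.
have s0 : 0 < (Num.sqrt 2)^-1 :> R by rewrite invr_gt0 sqrtr_gt0.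
pose c : R := (Num.sqrt (pi *+ 2))^-1.
have E : @phi R = (fun x : R => c * gauss_fun (x * (Num.sqrt 2)^-1)).
  apply/funext => x; rewrite phiE /gauss_fun exprMn exprVn sqr_sqrtr//.
  by rewrite mulNr.
rewrite E -[X in _ --> X](mulr0 c); apply: cvgMr.
apply: (@cvg_comp _ _ _ (fun x : R => x * (Num.sqrt 2)^-1) (@gauss_fun R) _ +oo%R).
  by apply/gt0_cvgMly => //; exact: cvg_id.
exact: cvg_gauss_fun.
Qed.

Lemma phi_derive (z : R) : is_derive z 1 (@phi R) (- z * phi z).
Proof.
have E : @phi R = (fun x : R => (Num.sqrt (pi *+ 2))^-1 * expR (- x ^+ 2 / 2)).
  by apply/funext => x; rewrite phiE.
have d1 : is_derive z 1 (fun x : R => - x ^+ 2 / 2) (- z).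
  by apply: is_derive_eq; rewrite /GRing.scale/=; field.
have d2 := @is_derive1_comp _ expR (fun x : R => - x ^+ 2 / 2) z _ _ (is_derive_expR _) d1.
have := is_deriveZ (Num.sqrt (pi *+ 2))^-1 d2.
rewrite {1}E => /is_derive_eq; apply.
by rewrite /GRing.scale/= phiE; ring.
Qed.

(** On [t, +oo[ the density is at most z phi(z) / t, which has the antiderivative - phi(z) / t. *)
Lemma upper_tail (t : R) : 0 < t -> GE (\1_(`[t, +oo[%classic) : R -> R) <= phi t / t.
Proof.
move=> t0; rewrite GE_indic//.
have m1 : measurable_fun setT (fun z : R => z * phi z / t).
  by apply: measurable_funM => //; apply: measurable_funM => //; exact: measurable_phi.
have fin1 : (\int[mu]_(x in `[t, +oo[) (phi x)%:E)%E \is a fin_num.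
  apply: integrable_fin_num => //.
  by apply: (integrableS measurableT) => //; exact: integrable_normal_pdf.
rewrite -lee_fin fineK//.
have -> : ((phi t / t)%:E = 0%:E - (- (phi t / t))%:E :> \bar R)%E.
  by rewrite -EFinB sub0r opprK.
have d1 (z : R) : is_derive z 1 (fun z => - (phi z / t)) (z * phi z / t).
  have d0 := phi_derive z.
  by apply: is_derive_eq; rewrite /GRing.scale/=; field; rewrite gt_eqF.
rewrite -(@ge0_continuous_FTC2y _ (fun z => z * phi z / t) (fun z => - (phi z / t)) t 0).
- apply: ge0_le_integral => //.
  + by move=> x _; rewrite lee_fin phi_ge0.
  + by apply/measurable_EFinP; apply: measurable_funTS; exact: measurable_phi.
  + by apply/measurable_EFinP; apply: measurable_funTS.
  + move=> x; rewrite /= in_itv/= andbT => tx; rewrite lee_fin.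
    by rewrite mulrAC ler_peMl ?phi_ge0// ler_pdivlMr// mul1r.
- by move=> x tx; rewrite divr_ge0 ?mulr_ge0 ?phi_ge0// ?(ltW t0)// (le_trans _ tx)// ltW.
- apply: continuous_subspaceT => x; apply: cvgM; last exact: cvg_cst.
  by apply: cvgM; [exact: cvg_id|exact: continuous_phi].
- rewrite -oppr0 -(mul0r t^-1); apply: cvgN; apply: cvgMl; exact: phi_cvg.
- by move=> x _; exact: (@ex_derive _ _ _ _ _ _ _ (d1 x)).
- apply: cvg_at_right_filter; apply: cvgN; apply: cvgMl; exact: continuous_phi.
- by move=> x _; rewrite derive1E; exact: (@derive_val _ _ _ _ _ _ _ (d1 x)).
Qed.

Lemma GE_le_upper_tail (t : R) (F : R -> R) : measurable_fun setT F -> 0 < t ->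
  (forall z, `|F z| <= \1_(`[t, +oo[%classic) z) -> GE F <= phi t / t.
Proof.
move=> mF t0 Ft; have iA := @Gint_indic `[t, +oo[%classic (measurable_itv _).
apply: le_trans (upper_tail t0); apply: GE_le => //; first exact: Gint_le iA Ft.
by move=> z; rewrite (le_trans _ (Ft z))// ler_norm.
Qed.

Lemma lower_tail (t : R) : 0 < t -> GE (\1_(`]-oo, - t]%classic) : R -> R) <= phi t / t.
Proof.
move=> t0; rewrite -GE_opp//.
apply: GE_le_upper_tail => //.
  apply: measurableT_comp; last by apply: continuous_measurable_fun => x; exact: opp_continuous.
  by apply: measurable_indic.
move=> z; rewrite !indicE ger0_norm// ler_nat.
case: (boolP (- z \in _)) => // /set_mem; rewrite /= in_itv/= lerN2 => tz.
by rewrite (mem_set _)// /= in_itv/= andbT.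
Qed.

(** Only [t, t + 1] is kept, where the density is at least its value at t + 1. *)
Lemma upper_tail_ge (t : R) : 0 <= t ->
  phi (t + 1) <= GE (\1_(`[t, +oo[%classic) : R -> R).
Proof.
move=> t0; rewrite -[leLHS]mulr1.
have -> : phi (t + 1) * 1 = fine (\int[mu]_(x in `[t, (t + 1)%R]) (phi (t + 1))%:E)%E.
  rewrite integral_cst//= lebesgue_measure_itv/= lte_fin ltrDl ltr01.
  by rewrite -EFinD addrAC subrr add0r.
rewrite GE_indic//.
have le1 : (\int[mu]_(x in `[t, (t + 1)%R]) (phi (t + 1))%:E <= \int[mu]_(x in `[t, (t+1)%R]) (phi x)%:E)%E.
  apply: ge0_le_integral => //.
  + by move=> x _; rewrite lee_fin phi_ge0.
  + by apply/measurable_EFinP; apply: measurable_funTS; exact: measurable_phi.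
  + move=> x; rewrite /= in_itv/= => /andP[tx xt]; rewrite lee_fin !phiE.
    rewrite ler_wpM2l ?invr_ge0 ?sqrtr_ge0// ler_expR ler_wpM2r// lerN2.
    by rewrite lerXn2r// nnegrE; lra.
have le2 : (\int[mu]_(x in `[t, (t + 1)%R]) (phi x)%:E <= \int[mu]_(x in `[t, +oo[) (phi x)%:E)%E.
  apply: ge0_subset_integral => //.
  + by apply/measurable_EFinP; apply: measurable_funTS; exact: measurable_phi.
  + by move=> x _; rewrite lee_fin phi_ge0.
  + by move=> x; rewrite /= !in_itv/= => /andP[->].
apply: fine_le; [| |exact: le_trans le1 le2].
  by rewrite integral_cst//= lebesgue_measure_itv/= lte_fin ltrDl ltr01.
apply: integrable_fin_num => //.
by apply: (integrableS measurableT) => //; exact: integrable_normal_pdf.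
Qed.

End normal_tail.

(** * Tails of linear forms of the noise *)

Section gaussian_tails.
Variables (R : realType) (d : measure_display) (T : measurableType d)
  (P : probability T R) (p : nat) (xi : 'I_p -> {RV P >-> R}).
Hypothesis hxi : standard_gaussian xi.

Lemma sg_measurable (lam v : R) : measurable_fun setT (sg lam v).
Proof.
apply: continuous_measurable_fun => s.
apply: differentiable_continuous; apply/derivable1_diffP.
exact: (@ex_derive _ _ _ _ _ _ _ (sg_derive lam v s)).
Qed.

Lemma sgp_coord_measurable (lam v : R) n (h : 'I_n -> T -> R) :
  (forall j, measurable_fun setT (h j)) ->
  measurable_fun setT (fun w => sgp lam v (\row_j h j w)).
Proof.
move=> mh; rewrite /sgp.
apply: measurable_prod => j _.
rewrite (_ : (fun _ => _) = sg lam v \o h j).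
  by apply: measurableT_comp => //; exact: sg_measurable.
by apply/funext => w; rewrite /= mxE.
Qed.

Definition lin (c : 'I_p -> R) (w : T) : R := \sum_i c i * xi i w.

Lemma lin_measurable c : measurable_fun setT (lin c).
Proof.
apply: measurable_sum => i; apply: measurable_funM => //; exact: measurable_funP.
Qed.

Lemma sg_ge (lam v s u : R) : 0 <= lam -> s <= u -> sg lam v u <= sg lam v s.
Proof.
move=> l0 su; rewrite /sg lef_pV2 ?posrE ?ltr_pwDl ?expR_ge0//.
by rewrite lerD2l ler_expR ler_wpM2l// lerB.
Qed.

(** The transposed family: the vector of all [lin (psi j)] is the sum of the [xi i *: colsof psi i],
    the form required by [expectation_gausses]. *)
Definition colsof n (psi : 'I_n -> 'I_p -> R) (i : 'I_p) : 'rV[R]_n := \row_j psi j i.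

(** Markov's inequality for [sgp]: on the event each of its n factors is at least [sg lam v u]. *)
Lemma prob_le_gausses n (psi : 'I_n -> 'I_p -> R) (lam v u : R) : 0 <= lam ->
  fine (P [set w | forall j, lin (psi j) w <= u]) * sg lam v u ^+ n
  <= gausses (map (colsof psi) (index_enum 'I_p)) (@sgp R lam v n) 0.
Proof.
move=> l0; set A := [set w | _].
have mA : measurable A.
  have -> : A = \bigcap_(j in [set: 'I_n]) (lin (psi j) @^-1` [set` `]-oo, u]]).
    apply/seteqP; split => [w Aw j _|w Aw j]; first by rewrite /= in_itv/=; exact: Aw.
    by have := Aw j I; rewrite /= in_itv.
  apply: fin_bigcap_measurable; first exact: finite_finset.
  by move=> j _; rewrite -[_ @^-1` _]setTI; apply: lin_measurable => //; exact: measurable_itv.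
have tf := sgp_tame v l0 n.
rewrite -(expectation_gausses hxi (colsof psi) tf); last first.
  by move=> h mh; exact: sgp_coord_measurable.
rewrite -PE_indic//.
have iA : Pint P (\1_A : T -> R).
  apply: (@Pint_bounded _ _ _ _ _ 1); first exact: measurable_indic.
  by move=> w; rewrite indicE; case: (_ \in _); rewrite ?normr1 ?normr0.
rewrite /PE -RintegralZr//; apply: PE_le.
- apply: (@Pint_bounded _ _ _ _ _ (sg lam v u ^+ n)).
    by apply: measurable_funM => //; exact: measurable_indic.
  have s0 : 0 <= sg lam v u ^+ n by rewrite exprn_ge0// ltW// sg_gt0.
  move=> w; rewrite indicE; case: (_ \in _); rewrite ?mul1r ?mul0r ?normr0//.
  by rewrite ger0_norm.
- apply: (@Pint_bounded _ _ _ _ _ 1).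
    rewrite (_ : (fun _ => _) = (fun w => sgp lam v (\row_j lin (psi j) w))).
      by apply: sgp_coord_measurable => // j; exact: lin_measurable.
    apply/funext => w; congr (@sgp R lam v n _); apply/rowP => j.
    rewrite add0r summxE mxE; apply: eq_bigr => i _; by rewrite !mxE mulrC.
  by move=> w; have /andP[? ?] := sgp01 lam v (0 + \sum_i xi i w *: colsof psi i); rewrite ger0_norm.
move=> w; rewrite indicE; case: (boolP (w \in A)) => [/set_mem Aw|_]; last first.
  by rewrite mul0r; case/andP: (sgp01 lam v (0 + \sum_i xi i w *: colsof psi i)).
rewrite mul1r /sgp.
have -> : sg lam v u ^+ n = \prod_(j < n) sg lam v u by rewrite prodr_const card_ord.
apply: ler_prod => j _; rewrite ltW ?sg_gt0//=; apply: sg_ge => //.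
rewrite add0r summxE; apply: le_trans (Aw j); rewrite le_eqVlt; apply/orP; left; apply/eqP.
by apply: eq_bigr => i _; rewrite !mxE mulrC.
Qed.

Lemma gram_colsof n (psi : 'I_n -> 'I_p -> R) j k :
  gram (map (colsof psi) (index_enum 'I_p)) j k = \sum_i psi j i * psi k i.
Proof. by rewrite /gram big_map; apply: eq_bigr => i _; rewrite !mxE. Qed.

(* In dimension 1 Slepian's comparison has equal variances on both sides and thus
   compares the law of a unit linear form to the standard normal law. *)
Lemma linear_tail_approx (c : 'I_p -> R) (t k lam : R) :
  \sum_i c i ^+ 2 = 1 -> 0 < k -> 2 * k < t -> 0 <= lam ->
  fine (P [set w | lin c w <= - t]) * (1 - expR (- (lam * k)))
   <= phi (t - 2 * k) / (t - 2 * k) + expR (- (lam * k)).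
Proof.
(* The level [v] lies halfway between - t and - t + 2k: the logistic step is at least 1 - exp(- lam
   k) below the former and at most exp(- lam k) above the latter. *)
move=> c1 k0 kt l0; set v := - t + k.
have e0 := expR_ge0 (- (lam * k)).
have := prob_le_gausses (fun _ : 'I_1 => c) v (- t) l0.
rewrite (_ : [set w | forall j, lin c w <= - t] = [set w | lin c w <= - t]); last first.
  by apply/seteqP; split => w H // ; exact: (H ord0).
have -> : sg lam v (- t) = (1 + expR (- (lam * k)))^-1.
  by rewrite /sg /v; congr (_ + expR _)^-1; ring.
rewrite expr1 => H.
apply: (@le_trans _ _ (fine (P [set w | lin c w <= - t]) / (1 + expR (- (lam * k))))).
  rewrite ler_wpM2l ?fineP_ge0// -[leRHS]mul1r ler_pdivlMr ?ltr_pwDl//.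
  rewrite mulrBl mul1r; have := sqr_ge0 (expR (- (lam * k))); nra.
apply: (le_trans H).
have H2 := @slepian _ lam v l0 1 (map (colsof (fun _ => c)) (index_enum 'I_p)) [:: const_mx 1] 0.
apply: (le_trans (H2 _ _)).
- move=> j; rewrite gram_colsof /gram big_seq1 !mxE mulr1 -c1.
  by apply: eq_bigr => i _; rewrite expr2.
- by move=> i j; rewrite !ord1 eqxx.
rewrite /gausses/= /gauss.
set q := t - 2 * k; have q0 : 0 < q by rewrite subr_gt0.
have iI := @Gint_indic R `]-oo, - q]%classic (measurable_itv _).
apply: le_trans (_ : GE (fun z : R => \1_(`]-oo, - q]%classic) z + expR (- (lam * k))) <= _); last first.
  rewrite GED//; last exact: Gint_cst.
  by rewrite GE_cst lerD2r lower_tail.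
apply: GE_le; [exact: tame_Gint (sgp_tame v l0 1)|by apply: GintD => //; exact: Gint_cst|].
move=> z; rewrite /sgp big_ord1 !mxE add0r mulr1 indicE.
case: (boolP (z \in _)) => zq.
  by apply: le_trans (sg_le1 _ _ _) _; rewrite lerDl.
have {}zq : - q < z.
  rewrite ltNge; apply: contra zq => zq; apply/mem_set; by rewrite /= in_itv.
rewrite add0r; apply: le_trans (@sg_ge lam v (- q) z l0 (ltW zq)) _.
rewrite /sg /v /q expRN lef_pV2 ?posrE ?ltr_pwDl ?expR_ge0 ?expR_gt0//.
by rewrite (_ : lam * _ = lam * k) ?lerDr//; ring.
Qed.

Lemma linear_tail (c : 'I_p -> R) (t : R) : \sum_i c i ^+ 2 = 1 -> 0 < t ->
  fine (P [set w | lin c w <= - t]) <= phi t / t.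
Proof.
move=> c1 t0; set q := fine _.
have q0 : 0 <= q by exact: fineP_ge0.
have q1 : q <= 1.
  apply: fineP_le1; rewrite (_ : [set w | _] = lin c @^-1` [set` `]-oo, - t]]).
    by rewrite -[_ @^-1` _]setTI; apply: lin_measurable => //; exact: measurable_itv.
  by apply/seteqP; split => w; rewrite /= in_itv.
(* The slack 2k absorbs both error terms of [linear_tail_approx]: since q <= 1 they add up to at
   most 2 exp(- lam k), and lam = k^-2 gives exp(- 1/k) <= k. *)
pose F (k : R) := phi (t - 2 * k) / (t - 2 * k) + 2 * k.
have cF : F k @[k --> 0^'+] --> phi t / t.
  apply: cvg_at_right_filter.
  have -> : phi t / t = F 0 by rewrite /F mulr0 subr0 addr0.
  have ct : continuous (fun k : R => t - 2 * k).
    move=> k; apply: cvgB; first exact: cvg_cst.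
    by apply: cvgM; [exact: cvg_cst|exact: cvg_id].
  apply: cvgD; last by apply: cvgM; [exact: cvg_cst|exact: cvg_id].
  apply: cvgM.
    apply: (@cvg_comp _ _ _ (fun k : R => t - 2 * k) (@phi R)); first exact: ct.
    exact: continuous_phi.
  apply: cvgV; last exact: ct.
  by rewrite mulr0 subr0 gt_eqF.
rewrite -(cvg_lim _ cF)//; apply: limr_ge; first by apply/cvg_ex; exists (phi t / t).
near=> k.
have k0 : 0 < k by near: k; exact: nbhs_right_gt.
have kt : 2 * k < t.
  rewrite mulrC -ltr_pdivlMr//; near: k; apply: nbhs_right_lt; by rewrite divr_gt0.
have l0 : 0 <= k^-1 ^+ 2 by rewrite sqr_ge0.
have := linear_tail_approx c1 k0 kt l0; rewrite -/q.
have -> : k^-1 ^+ 2 * k = k^-1 by rewrite expr2 -mulrA mulVf ?mulr1// gt_eqF.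
have ek : expR (- k^-1) <= k.
  rewrite expRN -[leRHS]invrK lef_pV2 ?posrE ?invr_gt0 ?expR_gt0//.
  have := expR_ge1Dx k^-1; lra.
have := expR_ge0 (- k^-1); rewrite /F; set e := expR _ in ek *.
set x := phi _ / _; nra.
Unshelve. all: by end_near. Qed.

End gaussian_tails.

(** * The maximum of correlated Gaussians *)

Section equicorrelated.
Variable R : realType.
Variables (n : nat) (lam v c : R).
Hypothesis lam0 : 0 <= lam.

Definition sgh (y : R) : R := GE (fun w : R => sg lam v (y + w * c)).

Lemma Gint_sg y : Gint (fun w : R => sg lam v (y + w * c)).
Proof.
apply: (@Gint_bounded _ _ 1).
  apply: (@measurableT_comp _ _ _ _ _ _ (sg lam v)); first exact: sg_measurable.
  by apply: measurable_funD => //; exact: measurable_funM.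
by move=> z; rewrite ger0_norm ?sg_le1// ltW// sg_gt0.
Qed.

(** Smoothing along an axis moves one coordinate only, hence acts on one factor of the product. *)
Lemma gausses_axes (s : seq 'I_n) (x : 'rV[R]_n) : uniq s ->
  gausses [seq c *: delta_mx ord0 j | j <- s] (@sgp R lam v n) x =
  \prod_j (if j \in s then sgh (x ord0 j) else sg lam v (x ord0 j)).
Proof.
elim: s x => [|i s IH] x; first by move=> _; apply: eq_bigr.
rewrite cons_uniq => /andP[iNs us] /=; rewrite -/(gausses _ _) /gauss.
pose C := \prod_(j | j != i) (if j \in s then sgh (x ord0 j) else sg lam v (x ord0 j)).
transitivity (GE (fun z : R => C * sg lam v (x ord0 i + z * c))).
  apply: GE_eq => z; rewrite IH// (bigD1 i)//= (negPf iNs) mulrC; congr (_ * _).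
    apply: eq_bigr => j ji; rewrite !mxE eqxx (negPf ji) !mulr0 addr0//.
  by rewrite !mxE !eqxx mulr1.
rewrite GEZ; last exact: Gint_sg.
rewrite [RHS](bigD1 i)//= mem_head mulrC; congr (_ * _).
by apply: eq_bigr => j ji; rewrite in_cons (negPf ji).
Qed.

End equicorrelated.

Section max_lower_tail.
Variables (R : realType) (d : measure_display) (T : measurableType d)
  (P : probability T R) (p : nat) (xi : 'I_p -> {RV P >-> R}).
Hypothesis hxi : standard_gaussian xi.

(** With steepness ln n, each logistic factor one unit below its level equals 1 / (1 + 1/n), so the
    product of n factors stays bounded below. *)
Lemma expR1_lb (n : nat) : (0 < n)%N -> expR (- 1) <= ((1 + n%:R^-1)^-1 : R) ^+ n.
Proof.
move=> n0; rewrite expRN exprVn lef_pV2 ?posrE ?expR_gt0 ?exprn_gt0 ?ltr_pwDl ?invr_ge0//.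
have -> : expR 1 = expR (n%:R^-1 : R) ^+ n.
  by rewrite -expRM_natl mulfV// pnatr_eq0 -lt0n.
by rewrite lerXn2r// ?nnegrE ?addr_ge0 ?expR_ge0 ?invr_ge0// expR_ge1Dx.
Qed.

(* Comparison with sqrt mu * z + sqrt (1 - mu) * w_j, z and the w_j independent;
   the two terms are the contributions of z <= - s and of z > - s.  The steepness
   lam = ln n makes the surrogate at least exp(-1) on the event. *)
Lemma max_lower_tail n (psi : 'I_n -> 'I_p -> R) (mu u s t : R) :
  (0 < n)%N -> 0 <= mu -> mu <= 1 ->
  (forall j, \sum_i psi j i ^+ 2 = 1) ->
  (forall j k, j != k -> \sum_i psi j i * psi k i <= mu) ->
  0 < s -> 0 <= t -> u + 1 + Num.sqrt mu * s <= Num.sqrt (1 - mu) * t ->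
  fine (P [set w | forall j, lin xi (psi j) w <= u])
  <= expR 1 * (phi s / s + expR (- (n%:R / 2 * phi (t + 1)))).
Proof.
move=> n0 mu0 mu1 psi1 psimu s0 t0 ust.
set lam : R := ln n%:R; set v := u + 1; set c := Num.sqrt (1 - mu).
have l0 : 0 <= lam by rewrite ln_ge0// ler1n.
have c0 : 0 <= c by exact: sqrtr_ge0.
set q := fine _.
have q0 : 0 <= q by exact: fineP_ge0.
have H := prob_le_gausses hxi psi v u l0.
have sgu : expR (- 1) <= sg lam v u ^+ n.
  rewrite /sg /v (_ : lam * _ = - lam); last by ring.
  by rewrite expRN lnK ?posrE ?ltr0n//; exact: expR1_lb.
rewrite -/q in H.
rewrite -ler_pdivrMl ?expR_gt0// -expRN.
rewrite mulrC; apply: le_trans (ler_wpM2l q0 sgu) _; apply: (le_trans H).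
pose l2 := const_mx (Num.sqrt mu) :: [seq c *: delta_mx ord0 j | j <- index_enum 'I_n] : seq 'rV[R]_n.
have gl2 j k : gram l2 j k = mu + (1 - mu) * (j == k)%:R.
  rewrite /gram big_cons !mxE -expr2 sqr_sqrtr// big_map; congr (_ + _).
  rewrite (bigD1 j)//= big1 => [|i ij]; last first.
    by rewrite !mxE (eq_sym j i) (negPf ij) andbF !mulr0 mul0r.
  by rewrite addr0 !mxE !eqxx/= mulr1 mulrA -expr2 sqr_sqrtr ?subr_ge0// eq_sym.
apply: le_trans (@slepian _ lam v l0 n _ l2 0 _ _) _.
- move=> j; rewrite gram_colsof gl2 eqxx mulr1 addrC subrK -(psi1 j).
  by apply: eq_bigr => i _; rewrite expr2.
- by move=> j k jk; rewrite gram_colsof gl2 (negPf jk) mulr0 addr0 psimu.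
have tg : tame lam (gausses [seq c *: delta_mx ord0 j | j <- index_enum 'I_n] (@sgp R lam v n)).
  exact/tame_gausses/sgp_tame.
rewrite /l2 /= -/(gausses _ _) /gauss.
have iI := @Gint_indic R `]-oo, - s]%classic (measurable_itv _).
set E := expR (- (n%:R / 2 * phi (t + 1))).
apply: le_trans (_ : GE (fun z : R => \1_(`]-oo, - s]%classic) z + E) <= _); last first.
  rewrite GED//; last exact: Gint_cst.
  by rewrite GE_cst lerD2r lower_tail.
apply: GE_le; [exact: tame_Gint tg|by apply: GintD => //; exact: Gint_cst|].
move=> z; have := tg.1 (0 + z *: const_mx (Num.sqrt mu)) => /andP[_ g1].
rewrite indicE; case: (boolP (z \in _)) => zs.
  by apply: (le_trans g1); rewrite lerDl expR_ge0.
have {}zs : - s < z.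
  rewrite ltNge; apply: contra zs => zs; apply/mem_set; by rewrite /= in_itv.
rewrite add0r gausses_axes ?index_enum_uniq//.
rewrite (eq_bigr (fun=> sgh lam v c (z * Num.sqrt mu))); last first.
  by move=> j _; rewrite mem_index_enum !mxE.
rewrite prodr_const card_ord.
have iJ := @Gint_indic R `[t, +oo[%classic (measurable_itv _).
(* For z > - s, a value w >= t lifts the coordinate above [v], where the logistic step is at most
   1/2. *)
have hb : sgh lam v c (z * Num.sqrt mu) <= 1 - 2^-1 * phi (t + 1).
  apply: le_trans (_ : GE (fun w : R => 1 + (- 2^-1) * \1_(`[t, +oo[%classic) w) <= _); last first.
    rewrite GED; [|exact: Gint_cst|exact: GintZ].
    by rewrite GE_cst GEZ// mulNr lerD2l lerN2 ler_pM2l// upper_tail_ge.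
  apply: GE_le; [exact: Gint_sg|by apply: GintD; [exact: Gint_cst|exact: GintZ]|].
  move=> w; rewrite indicE; case: (boolP (w \in _)) => [/set_mem|_]; last first.
    by rewrite mulr0 addr0 sg_le1.
  rewrite /= in_itv/= andbT => tw.
  apply: le_trans (@sg_ge R lam v v _ l0 _) _.
    have ust' : v + Num.sqrt mu * s <= c * t by exact: ust.
    apply: le_trans (_ : c * t - Num.sqrt mu * s <= _); first by lra.
    have sm0 : 0 <= Num.sqrt mu by exact: sqrtr_ge0.
    have := ler_wpM2l c0 tw; have := ler_wpM2l sm0 (ltW zs); lra.
  by rewrite /sg subrr mulr0 expR0 (_ : 1 + 1 = 2 :> R); [lra|ring].
have h0 : 0 <= sgh lam v c (z * Num.sqrt mu).
  rewrite -(GE_cst (0:R)); apply: GE_le; [exact: Gint_cst|exact: Gint_sg|].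
  by move=> w; rewrite ltW// sg_gt0.
apply: le_trans (_ : expR (- (2^-1 * phi (t + 1))) ^+ n <= _).
  rewrite lerXn2r ?nnegrE ?expR_ge0//; apply: (le_trans hb); exact: expR_ge1Dx.
by rewrite -expRM_natl /E add0r mulrN mulrA.
Qed.

End max_lower_tail.

(** * Explicit constants for the maximum *)

Section bounds.
Variable R : realType.

Lemma expR1_lt3 : expR 1 < 3 :> R.
Proof.
have h : 5 / 6 <= expR (- (1 / 6)) :> R.
  by apply: le_trans (expR_ge1Dx _); lra.
have h6 : (5 / 6) ^+ 6 <= expR (- 1) :> R.
  have -> : - 1 = 6%:R * (- (1 / 6)) :> R by field.
  by rewrite expRM_natl lerXn2r// nnegrE ?expR_ge0//; lra.
rewrite -[ltLHS]invrK -expRN -[ltRHS]invrK ltf_pV2 ?posrE ?expR_gt0 ?invr_gt0//.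
by apply: lt_le_trans h6; lra.
Qed.

Lemma ln_gt1 (n : nat) : (3 <= n)%N -> 1 < ln n%:R :> R.
Proof.
move=> n3; have n0 : (0 < n)%N by exact: leq_trans n3.
rewrite -[ltLHS]expRK ltr_ln ?posrE ?expR_gt0 ?ltr0n//.
by apply: lt_le_trans expR1_lt3 _; rewrite ler_nat.
Qed.

Lemma sqrt_2pi_bounds : 1 <= Num.sqrt (pi *+ 2 : R) <= 3.
Proof.
have p2 : 2 <= pi :> R by exact: pi_ge2.
have p4 : pi / 2 < 2 :> R by exact: pihalf_lt2.
have p0 : 0 <= pi *+ 2 :> R by rewrite mulrn_wge0 ?pi_ge0.
have p0' : 0 < pi *+ 2 :> R by rewrite mulrn_wgt0 ?pi_gt0.
apply/andP; split.
  by rewrite -[leLHS]sqrtr1 ler_sqrt// mulr2n; lra.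
rewrite -(@ger0_norm _ 3)// -sqrtr_sqr ler_sqrt ?sqr_ge0//.
by rewrite mulr2n; lra.
Qed.

Lemma phi_le (z : R) : phi z <= expR (- z ^+ 2 / 2).
Proof.
rewrite phiE ler_piMl ?expR_ge0// invf_le1; case/andP: sqrt_2pi_bounds => //.
by move=> h _; exact: lt_le_trans h.
Qed.

Lemma phi_ge (z : R) : expR (- z ^+ 2 / 2) / 3 <= phi z.
Proof.
case/andP: sqrt_2pi_bounds => h1 h3.
rewrite phiE mulrC ler_wpM2r ?expR_ge0// lef_pV2 ?posrE//.
exact: lt_le_trans h1.
Qed.

(** With a = sqrt(ln ln n) and l = sqrt(2 ln n), [max_lower_tail] is used at s = 2 a / sqrt mu and t
    = l - 2 a. The constant 5 is 2 + 2 + 1: the common part costs sqrt mu * s = 2 a, the lowered t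
    costs at most 2 a, and the unit between [u] and the logistic level at most a. *)
Lemma max_lower_tail_bound (d : measure_display) (T : measurableType d)
  (P : probability T R) (p : nat) (xi : 'I_p -> {RV P >-> R})
  (n : nat) (psi : 'I_n -> 'I_p -> R) (mu : R) :
  standard_gaussian xi -> (3 <= n)%N -> 0 < mu -> mu < 1 ->
  (forall j, \sum_i psi j i ^+ 2 = 1) ->
  (forall j k, j != k -> \sum_i psi j i * psi k i <= mu) ->
  let th := Num.sqrt (ln (ln n%:R) * Num.min mu^-1 (ln n%:R)) : R in
  1 < 100^-1 * th ->
  fine (P [set w | forall j, lin xi (psi j) w <=
     Num.sqrt (2 * (1 - mu) * ln n%:R) - 5 * Num.sqrt (ln (ln n%:R))])
  <= 6 * expR (- 100^-1 * th).
Proof.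
move=> hxi n3 mu0 mu1 psi1 psimu th th1.
have n0 : (0 < n)%N by exact: leq_trans n3.
set x : R := ln n%:R; set y : R := ln x.
have th100 : 100 < th by rewrite mulrC ltr_pdivlMr ?mul1r in th1.
have x1 : 1 < x by exact: ln_gt1.
have x0 : 0 < x by exact: lt_trans x1.
have y0 : 0 <= y by rewrite /y ln_ge0// ltW.
have mi0 : 0 < mu^-1 by rewrite invr_gt0.
set Th := y * Num.min mu^-1 x.
have Th0 : 0 <= Th by rewrite mulr_ge0// le_min !ltW.
have thE : th = Num.sqrt Th by [].
have Thth : Th = th ^+ 2 by rewrite thE sqr_sqrtr.
have Thy : Th <= y * mu^-1 by rewrite /Th ler_wpM2l// ge_min lexx.
have Thx : Th <= y * x by rewrite /Th ler_wpM2l// ge_min lexx orbT.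
have th0 : 0 < th by lra.
(* Otherwise x <= e < 3 and th^2 <= y x <= 3, against th > 100. *)
have y1 : 1 <= y.
  rewrite leNgt; apply/negP => y1.
  have x3 : x <= 3.
    rewrite -[x]lnK ?posrE//; apply: le_trans (ltW expR1_lt3); by rewrite ler_expR ltW.
  have : y * x <= 1 * 3 by apply: ler_pM => //; exact: ltW.
  rewrite mul1r => h; have := le_trans Thx h; rewrite Thth; nra.
have xy : 2 * y <= x.
  rewrite -[leRHS]lnK ?posrE// -/y.
  have -> : y = 2%:R * (y / 2) by field.
  rewrite expRM_natl.
  have h : 1 + y / 2 <= expR (y / 2) by exact: expR_ge1Dx.
  have : (1 + y / 2) ^+ 2 <= expR (y / 2) ^+ 2 by rewrite lerXn2r ?nnegrE//; lra.
  apply: le_trans; have := sqr_ge0 (y / 2 - 1); lra.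
pose a := Num.sqrt y; pose l := Num.sqrt (2 * x).
have a2 : a ^+ 2 = y by rewrite sqr_sqrtr.
have l2 : l ^+ 2 = 2 * x by rewrite sqr_sqrtr// mulr_ge0// ltW.
have a1 : 1 <= a by rewrite -[leLHS]sqrtr1 ler_sqrt// (le_trans ler01).
have l0 : 0 <= l by exact: sqrtr_ge0.
have al : 2 * a <= l.
  rewrite -(ler_pXn2r (_ : 0 < 2)%N) ?nnegrE//; last by lra.
  by rewrite exprMn a2 l2; lra.
pose c := Num.sqrt (1 - mu); pose r := Num.sqrt mu.
have c0 : 0 <= c by exact: sqrtr_ge0.
have c1 : c <= 1 by rewrite -[leRHS]sqrtr1 ler_sqrt//; lra.
have r0 : 0 < r by rewrite sqrtr_gt0.
have r1 : r <= 1 by rewrite -[leRHS]sqrtr1 ler_sqrt//; lra.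
have -> : Num.sqrt (2 * (1 - mu) * ln n%:R) = c * l.
  by rewrite /c /l -sqrtrM ?subr_ge0 ?ltW// -/x; congr Num.sqrt; ring.
pose s := 2 * a / r.
have s0 : 0 < s by rewrite divr_gt0//; lra.
have s2 : 2 <= s by rewrite ler_pdivlMr//; nra.
have key := @max_lower_tail _ _ _ _ _ _ hxi n psi mu (c * l - 5 * a) s (l - 2 * a)
  n0 (ltW mu0) (ltW mu1) psi1 psimu s0.
rewrite -/x -/y; apply: (le_trans (key _ _)); first by lra.
  have -> : Num.sqrt mu * s = 2 * a by rewrite /s -/r mulrC divfK// gt_eqF.
  by rewrite -/c mulrBr; nra.
(* Here s^2 / 2 = 2 y / mu is at least 2 th^2: this is the branch 1 / mu of the minimum in [th]. *)
have H1 : phi s / s <= expR (- th).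
  apply: le_trans (_ : phi s <= _).
    by rewrite ler_pdivrMr// ler_peMr ?phi_ge0//; lra.
  apply: (le_trans (phi_le s)); rewrite ler_expR mulNr lerN2.
  have -> : s ^+ 2 = 4 * (y * mu^-1).
    by rewrite /s exprMn exprVn exprMn a2 [r ^+ 2]sqr_sqrtr ?ltW//; ring.
  have : th <= th ^+ 2 by nra.
  by rewrite -Thth; lra.
(* As t + 1 <= l - a and n = exp(l^2 / 2), the exponent is at least exp(l a - y / 2) / 6. This
   exceeds l a = sqrt(2 x y), which is at least th by the branch ln n of the minimum. *)
have H2 : expR (- (n%:R / 2 * phi (l - 2 * a + 1))) <= expR (- th).
  rewrite ler_expR lerN2.
  have q0 : 0 <= l - 2 * a + 1 by lra.
  have q1 : l - 2 * a + 1 <= l - a by lra.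
  have g1 := phi_ge (l - 2 * a + 1).
  have g2 : expR (- (l - a) ^+ 2 / 2) <= expR (- (l - 2 * a + 1) ^+ 2 / 2).
    rewrite ler_expR ler_wpM2r// lerN2 lerXn2r// nnegrE; lra.
  have nE : n%:R = expR x :> R by rewrite /x lnK// posrE ltr0n.
  have nn0 : 0 <= n%:R / 2 :> R by rewrite divr_ge0.
  apply: le_trans (_ : n%:R / 2 * (expR (- (l - a) ^+ 2 / 2) / 3) <= _); last first.
    by rewrite ler_wpM2l//; lra.
  have E1 : n%:R * expR (- (l - a) ^+ 2 / 2) = expR (l * a - y / 2).
    by rewrite nE -expRD; congr expR; rewrite sqrrB l2 a2; field.
  have -> : n%:R / 2 * (expR (- (l - a) ^+ 2 / 2) / 3) = expR (l * a - y / 2) / 6.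
    by rewrite -E1; field.
  have E2 : 3 / 4 * (l * a) <= l * a - y / 2 by rewrite -a2; nra.
  have E3 : (1 + 3 / 8 * (l * a)) ^+ 2 <= expR (l * a - y / 2).
    apply: le_trans (_ : expR (3 / 4 * (l * a)) <= _); last by rewrite ler_expR.
    have -> : 3 / 4 * (l * a) = 2%:R * (3 / 8 * (l * a)) by field.
    rewrite expRM_natl lerXn2r ?nnegrE ?expR_ge0 ?expR_ge1Dx//.
    by rewrite addr_ge0// !mulr_ge0//; lra.
  have la : th <= l * a.
    rewrite -(ler_pXn2r (_ : 0 < 2)%N) ?nnegrE//; [|exact: ltW|by rewrite mulr_ge0//; lra].
    rewrite exprMn a2 l2 -Thth.
    have : 0 <= y * x by rewrite mulr_ge0// ltW.
    lra.
  apply: (le_trans la); rewrite ler_pdivlMr//; apply: le_trans E3.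
  set q := l * a in la *; nra.
have E0 : expR (- th) <= expR (- 100^-1 * th) by rewrite ler_expR mulNr lerN2; lra.
(* The factor 6 bounds the prefactor e < 3 times two terms, each at most exp(- th). *)
have := ltW expR1_lt3; have := expR_ge0 (- th); have := expR_ge0 (1 : R).
set e := expR 1; set f := expR (- th) in H1 H2 E0 *; set g := expR _ in H2 *.
nra.
Qed.

End bounds.

(** * Optimal dictionaries and the first step of OMP *)

Section coherence_min.
Variable R : realType.

Lemma dotp_colE p N (A : 'M[R]_(p, N)) i j :
  dotp (col i A) (col j A) = \sum_k A k i * A k j.
Proof. by apply: eq_bigr => k _; rewrite !mxE. Qed.

Lemma dictionaryP p N (A : 'M[R]_(p, N)) :
  dictionary A <-> forall i, \sum_k A k i ^+ 2 = 1.
Proof.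
have E i : dotp (col i A) (col i A) = \sum_k A k i ^+ 2.
  by rewrite dotp_colE; apply: eq_bigr => k _; rewrite expr2.
split => H i; last by rewrite /norm2 E H sqrtr1.
have := H i; rewrite /norm2 E => /(congr1 (fun x => x ^+ 2)).
by rewrite sqr_sqrtr ?expr1n// sumr_ge0// => k _; exact: sqr_ge0.
Qed.

Lemma coherence_ge0 p N (A : 'M[R]_(p, N)) : 0 <= coherence A.
Proof. exact: bigmax_ge_id. Qed.

Lemma coherence_ge p N (A : 'M[R]_(p, N)) i j : i != j ->
  `|dotp (col i A) (col j A)| <= coherence A.
Proof.
by move=> ij; rewrite /coherence (bigmaxD1 (i, j))//= le_max lexx.
Qed.

Lemma coherence_le p N (A : 'M[R]_(p, N)) c : 0 <= c ->
  (forall i j, i != j -> `|dotp (col i A) (col j A)| <= c) -> coherence A <= c.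
Proof. by move=> c0 H; apply: bigmax_le => // -[i j] /= ij; exact: H. Qed.

Lemma coherence_le1 p N (A : 'M[R]_(p, N)) : dictionary A -> coherence A <= 1.
Proof.
move=> /dictionaryP dA; apply: coherence_le => // i j _; rewrite dotp_colE.
apply: le_trans (ler_norm_sum _ _ _) _.
apply: le_trans (_ : \sum_k (A k i ^+ 2 + A k j ^+ 2) / 2 <= _).
  apply: ler_sum => k _; have := sqr_ge0 (A k i - A k j); have := sqr_ge0 (A k i + A k j).
  by rewrite ler_norml => ? ?; apply/andP; split; nra.
by rewrite -mulr_suml big_split/= !dA; lra.
Qed.

Lemma continuous_maxr (T : topologicalType) (f g : T -> R) :
  continuous f -> continuous g -> continuous (fun v => Num.max (f v) (g v)).
Proof. by move=> cf cg x; exact: (@continuous_max R T f g x (cf x) (cg x)). Qed.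

Lemma continuous_sumr (T : topologicalType) (I : Type) (r : seq I) (F : I -> T -> R) :
  (forall i, continuous (F i)) -> continuous (fun v => \sum_(i <- r) F i v).
Proof.
move=> cF; elim: r => [|i r IH].
  rewrite [X in continuous X](_ : _ = cst 0); first exact: cst_continuous.
  by apply/funext => w; rewrite big_nil.
rewrite [X in continuous X](_ : _ = fun v => F i v + \sum_(i <- r) F i v).
  by move=> v; apply: cvgD; [exact: cF|exact: IH].
by apply/funext => w; rewrite big_cons.
Qed.

Lemma coord_continuous_rV k (j : 'I_k) : continuous (fun v : 'rV[R]_k => v ord0 j : R).
Proof. exact: coord_continuous. Qed.

Lemma coherence_continuous a b :
  continuous (fun v : 'rV[R]_(a * b) => coherence (vec_mx v : 'M[R]_(a, b))).
Proof.
rewrite /coherence; elim: (index_enum _) => [|ij r IH].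
  rewrite [X in continuous X](_ : _ = cst 0); first exact: cst_continuous.
  by apply/funext => w; rewrite big_nil.
case: (boolP (ij.1 != ij.2)) => h; last first.
  rewrite [X in continuous X](_ : _ = fun v : 'rV[R]_(a * b) =>
     \big[Num.max/0]_(ij <- r | ij.1 != ij.2)
      `|dotp (col ij.1 (vec_mx v : 'M[R]_(a, b))) (col ij.2 (vec_mx v : 'M[R]_(a, b)))|); first exact: IH.
  by apply/funext => w; rewrite big_cons (negPf h).
rewrite [X in continuous X](_ : _ = fun v : 'rV[R]_(a * b) =>
     Num.max `|dotp (col ij.1 (vec_mx v : 'M[R]_(a, b))) (col ij.2 (vec_mx v : 'M[R]_(a, b)))|
     (\big[Num.max/0]_(ij <- r | ij.1 != ij.2)
      `|dotp (col ij.1 (vec_mx v : 'M[R]_(a, b))) (col ij.2 (vec_mx v : 'M[R]_(a, b)))|)); last first.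
  by apply/funext => w; rewrite big_cons h.
apply: continuous_maxr; last exact: IH.
suff cd : continuous (fun v : 'rV[R]_(a * b) =>
    dotp (col ij.1 (vec_mx v : 'M[R]_(a, b))) (col ij.2 (vec_mx v : 'M[R]_(a, b)))).
  by move=> v; exact: (cvg_norm (cd v)).
rewrite [X in continuous X](_ : _ = fun v : 'rV[R]_(a * b) =>
   \sum_k v ord0 (mxvec_index k ij.1) * v ord0 (mxvec_index k ij.2)).
  apply: continuous_sumr => k v; exact: (cvgM (@coord_continuous_rV _ _ v) (@coord_continuous_rV _ _ v)).
by apply/funext => w; apply: eq_bigr => k _; rewrite !mxE.
Qed.

Lemma dictionary_compact a b :
  compact [set v : 'rV[R]_(a * b) | dictionary (vec_mx v : 'M[R]_(a, b))].
Proof.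
apply: bounded_closed_compact.
  exists 1; split; first exact: num_real.
  move=> M M1 v /dictionaryP dv; rewrite /Num.norm/= mx_normrE.
  apply: bigmax_le => [|[i j] _]; first by rewrite (le_trans ler01)// ltW.
  rewrite /= (ord1 i); apply: le_trans (ltW M1).
  case/mxvec_indexP: j => k l.
  have := dv l; rewrite (bigD1 k)//= !mxE => h.
  rewrite -(ler_pXn2r (_ : 0 < 2)%N) ?nnegrE// expr1n real_normK ?num_real//.
  by rewrite -h lerDl sumr_ge0// => *; exact: sqr_ge0.
rewrite (_ : [set v | _] = \bigcap_(i in [set: 'I_b])
   ((fun v : 'rV[R]_(a * b) => \sum_k v ord0 (mxvec_index k i) ^+ 2) @^-1` [set x | x = 1])).
  apply: closed_bigI => i _; apply: closed_comp; last exact: closed_eq.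
  move=> v _; apply: continuous_sumr => k {}v; exact: (cvgM (@coord_continuous_rV _ _ v) (@coord_continuous_rV _ _ v)).
apply/seteqP; split => v /=.
  move=> /dictionaryP h i _ /=; rewrite -(h i); apply: eq_bigr => k _; by rewrite mxE.
move=> h; apply/dictionaryP => i; rewrite -[RHS](h i I); apply: eq_bigr => k _; by rewrite mxE.
Qed.

(** Coherence is continuous on the compact set of dictionaries, which for a > 0 contains the matrix
    with all columns equal to the first basis vector. *)
Lemma mu_min_attained a b : (0 < a)%N ->
  exists2 Psi : 'M[R]_(a, b), dictionary Psi & coherence Psi = mu_min R a b.
Proof.
case: a => // a _.
pose A := [set v : 'rV[R]_(a.+1 * b) | dictionary (vec_mx v : 'M[R]_(a.+1, b))].
have A0 : A !=set0.
  exists (mxvec (\matrix_(k, j) (k == ord0)%:R)); rewrite /A /= mxvecK.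
  apply/dictionaryP => i; rewrite (bigD1 ord0)//= mxE eqxx expr1n big1 ?addr0//.
  by move=> k k0; rewrite mxE (negPf k0) expr0n.
have [v vA vmin] := @EVT_min_rV R _ _ A A0 (@dictionary_compact _ _)
   (continuous_subspaceT (@coherence_continuous a.+1 b)).
have dv : dictionary (vec_mx v : 'M[R]_(a.+1, b)) by move: vA => /set_mem.
exists (vec_mx v) => //; apply/eqP; rewrite eq_le; apply/andP; split.
  apply: lb_le_inf; first by exists (coherence (vec_mx v : 'M[R]_(a.+1, b))); exists (vec_mx v).
  move=> _ [Psi dPsi <-]; rewrite -[Psi]mxvecK; apply: vmin.
  by apply/mem_set; rewrite /A /= mxvecK.
apply: ge_inf; last by exists (vec_mx v).
by exists 0 => _ [Psi _ <-]; exact: coherence_ge0.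
Qed.

End coherence_min.

Section omp_first_step.
Variables (R : realType) (p N : nat) (Phi : 'M[R]_(p, N)) (s : 'cV[R]_p).

(** At the first step the estimate is zero, so the index chosen maximizes the correlation with [s]
    itself; no later step removes it. *)
Lemma omp_first t S xhat : omp Phi s t S xhat ->
  (t = 0%N /\ xhat = 0) \/
  exists2 j, j \in S & forall i, `|dotp (col i Phi) s| <= `|dotp (col j Phi) s|.
Proof.
elim=> [|{}t {}S {}xhat j xhat' _ [[_ ->] jmax|[k kS kmax] _] _]; first by left.
  right; exists j; first by rewrite in_setU1 eqxx.
  by move=> i; have := jmax i; rewrite mulmx0 subr0.
by right; exists k => //; rewrite in_setU1 kS orbT.
Qed.

Lemma omp_fails_of_first m (Omega : {set 'I_N}) (j : 'I_N) : (0 < m)%N ->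
  (forall i, i \in Omega -> `|dotp (col i Phi) s| < `|dotp (col j Phi) s|) ->
  omp_fails Phi s m Omega.
Proof.
move=> m0 H S xhat /omp_first [[m0' _]|[k kS kmax] SO]; first by rewrite m0' in m0.
by rewrite SO in kS; have := H k kS; rewrite ltNge kmax.
Qed.

End omp_first_step.

Section probability_bounds.
Variables (R : realType) (d : measure_display) (T : measurableType d)
  (P : probability T R).
Implicit Types A B : set T.

Lemma fineP_setU A B : measurable A -> measurable B ->
  fine (P (A `|` B)) <= fine (P A) + fine (P B).
Proof.
move=> mA mB; rewrite -fineD ?fin_num_measure//.
apply: fine_le; rewrite ?fin_numD ?fin_num_measure//; first exact: measurableU.
exact: measureU2.
Qed.

Lemma fineP_bigsetU (I : Type) (r : seq I) (A : I -> set T) c :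
  (forall i, measurable (A i)) -> (forall i, fine (P (A i)) <= c) ->
  fine (P (\big[setU/set0]_(i <- r) A i)) <= (size r)%:R * c.
Proof.
move=> mA Ac; elim: r => [|i r IH]; first by rewrite big_nil measure0 mul0r.
rewrite big_cons/= -natr1 mulrDl mul1r addrC.
apply: le_trans (fineP_setU (mA i) _) _; first exact: bigsetU_measurable.
exact: lerD.
Qed.

Variables (p : nat) (xi : 'I_p -> {RV P >-> R}).
Hypothesis hxi : standard_gaussian xi.

Lemma lin_le_measurable (c : 'I_p -> R) t : measurable [set w | lin xi c w <= t].
Proof.
rewrite (_ : [set w | _] = lin xi c @^-1` [set` `]-oo, t]]).
  by rewrite -[_ @^-1` _]setTI; apply: lin_measurable => //; exact: measurable_itv.
by apply/seteqP; split => w; rewrite /= in_itv.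
Qed.

(** The upper tail is written as the lower tail of the opposite form, so that [linear_tail] covers
    both. *)
Definition two_sided (c : 'I_p -> R) (t : R) : set T :=
  [set w | lin xi c w <= - t] `|` [set w | lin xi (fun i => - c i) w <= - t].

Lemma two_sided_measurable c t : measurable (two_sided c t).
Proof. by apply: measurableU; exact: lin_le_measurable. Qed.

Lemma two_sidedN c t w : ~ two_sided c t w -> `|lin xi c w| <= t.
Proof.
move=> H; rewrite ler_norml; apply/andP; split; rewrite leNgt; apply/negP => h.
  by apply: H; left; exact: ltW.
apply: H; right; rewrite /= /lin.
rewrite (_ : \sum_i _ = - lin xi c w); first by rewrite lerN2 ltW.
by rewrite /lin -sumrN; apply: eq_bigr => i _; rewrite mulNr.
Qed.

Lemma two_sided_tail c t : \sum_i c i ^+ 2 = 1 -> 0 < t ->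
  fine (P (two_sided c t)) <= 2 * (phi t / t).
Proof.
move=> c1 t0; apply: le_trans (fineP_setU _ _) _; [exact: lin_le_measurable..|].
rewrite mulr2n mulrDl mul1r; apply: lerD; apply: linear_tail => //.
by rewrite -c1; apply: eq_bigr => i _; rewrite sqrrN.
Qed.

(** Source of the last two terms of the probability: y = ln ln N yields the first of them, and y =
    beta ln N yields the second up to the factor N^(- beta). *)
Lemma two_phi_sqrt (y : R) : 0 < y ->
  2 * (phi (Num.sqrt (2 * y)) / Num.sqrt (2 * y)) = expR (- y) / Num.sqrt (pi * y).
Proof.
move=> y0; rewrite phiE sqr_sqrtr ?mulr_ge0 ?(ltW y0)//.
have -> : - (2 * y) / 2 = - y by field.
have -> : pi *+ 2 = 2 * pi :> R by rewrite mulr2n; ring.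
rewrite !sqrtrM ?pi_ge0//.
have s2 : Num.sqrt 2 ^+ 2 = 2 :> R by rewrite sqr_sqrtr.
have s20 : Num.sqrt 2 != 0 :> R by rewrite gt_eqF// sqrtr_gt0.
have p0 : Num.sqrt pi != 0 :> R by rewrite gt_eqF// sqrtr_gt0 pi_gt0.
have q0 : Num.sqrt y != 0 by rewrite gt_eqF// sqrtr_gt0.
by rewrite -[X in X * _]s2; field; rewrite s20 p0 q0.
Qed.

End probability_bounds.

(** * The block dictionary *)

Section block_dictionary.
Variables (R : realType) (m pt Nt : nat) (mu : R).
Hypothesis m0 : (0 < m)%N.
Local Notation M := (m%:R : R).
Hypothesis mu0 : 0 < mu.
Hypothesis mumax : (2 * M - 1) * mu < 1.

(* The atoms of the support are phi_i = alm e_i + gam (1, ..., 1); alm and gam are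
   chosen so that the phi_i are unit vectors with inner products - mu.  Their sum
   is bem (1, ..., 1), of squared norm m Dm, and their mean has norm rhom. *)
Definition Dm : R := 1 - (M - 1) * mu.
Definition rhom : R := Num.sqrt (Dm / M).
Definition mutm : R := mu ^+ 2 / rhom ^+ 2.
Definition alm : R := Num.sqrt (1 + mu).
Definition bem : R := Num.sqrt Dm.
Definition gam : R := (bem - alm) / M.

Lemma M_ge1 : 1 <= M. Proof. by rewrite ler1n. Qed.
Lemma M_gt0 : 0 < M. Proof. by rewrite ltr0n. Qed.
(** The bound mu < 1 / (2m - 1) rearranged. For x equal to 1 on the support, [Dm] and [M * mu] are
    the noiseless correlations of support and outer atoms; their gap is 1 - (2m - 1) mu. *)
Lemma Dm_gt : M * mu < Dm.
Proof. rewrite /Dm; move: mumax; lra. Qed.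
Lemma Dm_gt0 : 0 < Dm.
Proof. by apply: lt_trans Dm_gt; rewrite mulr_gt0// M_gt0. Qed.
Lemma bem_gt0 : 0 < bem. Proof. by rewrite sqrtr_gt0 Dm_gt0. Qed.
Lemma bem_sqr : bem ^+ 2 = Dm. Proof. by rewrite sqr_sqrtr// ltW// Dm_gt0. Qed.
Lemma alm_sqr : alm ^+ 2 = 1 + mu. Proof. by rewrite sqr_sqrtr// addr_ge0// ltW. Qed.
Lemma rhom_sqr : rhom ^+ 2 = Dm / M.
Proof. by rewrite sqr_sqrtr// divr_ge0// ltW// Dm_gt0. Qed.
Lemma mutmE : mutm = mu ^+ 2 * M / Dm.
Proof. by rewrite /mutm rhom_sqr invfM invrK; ring. Qed.
Lemma mu_lt1 : mu < 1.
Proof. have := M_ge1; move: mumax mu0; nra. Qed.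
Lemma mutm_gt0 : 0 < mutm.
Proof. by rewrite mutmE divr_gt0 ?Dm_gt0// mulr_gt0 ?M_gt0// exprn_gt0. Qed.
Lemma mutm_lt : mutm < mu.
Proof.
rewrite mutmE ltr_pdivrMr ?Dm_gt0// expr2 -mulrA ltr_pM2l// mulrC.
exact: Dm_gt.
Qed.
Lemma mutm_lt1 : mutm < 1. Proof. exact: lt_trans mutm_lt mu_lt1. Qed.

(* The other atoms have inner product mu with each phi_i, hence a projection of
   squared norm mutm on the span of the phi_i. *)
Definition block_dict (Psi : 'M[R]_(pt, Nt)) : 'M[R]_(m + pt, m + Nt) :=
  block_mx (\matrix_(k, i) (alm * (k == i)%:R + gam)) (const_mx (mu / bem))
           0 (Num.sqrt (1 - mutm) *: Psi).

Variable Psi : 'M[R]_(pt, Nt).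
Local Notation Phi := (block_dict Psi).

Lemma sum_left (i : 'I_m) (F : 'I_m -> R) :
  \sum_k (alm * (k == i)%:R + gam) * F k = alm * F i + gam * \sum_k F k.
Proof.
under eq_bigr do rewrite mulrDl -mulrA.
rewrite big_split/= -!mulr_sumr; congr (_ * _ + _).
rewrite (bigD1 i)//= eqxx mul1r big1 ?addr0// => k ki.
by rewrite (negPf ki) mul0r.
Qed.

Lemma dot_left (i : 'I_m) (F : 'I_(m + pt) -> R) :
  \sum_k Phi k (lshift Nt i) * F k =
  alm * F (lshift pt i) + gam * \sum_k F (lshift pt k).
Proof.
rewrite big_split_ord/= [X in _ + X]big1 ?addr0 => [|k _]; last first.
  by rewrite block_mxEdl mxE mul0r.
rewrite -sum_left; apply: eq_bigr => k _; by rewrite block_mxEul mxE.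
Qed.

Lemma dot_right (j : 'I_Nt) (F : 'I_(m + pt) -> R) :
  \sum_k Phi k (rshift m j) * F k =
  mu / bem * (\sum_k F (lshift pt k)) +
  Num.sqrt (1 - mutm) * \sum_k Psi k j * F (rshift m k).
Proof.
rewrite big_split_ord/= !mulr_sumr; congr (_ + _); apply: eq_bigr => k _.
  by rewrite block_mxEur mxE.
by rewrite block_mxEdr mxE mulrA.
Qed.

Lemma gamE : M * gam = bem - alm.
Proof. by rewrite /gam mulrC divfK// gt_eqF// M_gt0. Qed.

Lemma sum_Phi_left (i : 'I_m) : \sum_k Phi (lshift pt k) (lshift Nt i) = bem.
Proof.
under eq_bigr do rewrite block_mxEul mxE -[_ + gam]mulr1.
by rewrite sum_left sumr_const card_ord mulr1 [gam * _]mulrC gamE; ring.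
Qed.

(** The part independent of i and j is gam (alm + bem) = (bem^2 - alm^2) / M = (Dm - 1 - mu) / M = -
    mu. *)
Lemma gram_ll (i j : 'I_m) : dotp (col (lshift Nt i) Phi) (col (lshift Nt j) Phi)
  = (1 + mu) * (i == j)%:R - mu.
Proof.
rewrite dotp_colE dot_left sum_Phi_left block_mxEul mxE.
have -> : alm * (alm * (i == j)%:R + gam) + gam * bem =
  alm ^+ 2 * (i == j)%:R + (M * gam) * (alm + bem) / M.
  by field; rewrite gt_eqF// M_gt0.
have -> : M * gam * (alm + bem) / M = (bem ^+ 2 - alm ^+ 2) / M.
  by rewrite gamE; congr (_ / _); ring.
rewrite bem_sqr alm_sqr /Dm; congr (_ + _).
by field; rewrite gt_eqF// M_gt0.
Qed.

Lemma gram_lr (i : 'I_m) (j : 'I_Nt) :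
  dotp (col (lshift Nt i) Phi) (col (rshift m j) Phi) = mu.
Proof.
rewrite dotp_colE dot_left block_mxEur mxE.
under eq_bigr do rewrite block_mxEur mxE.
rewrite sumr_const card_ord -[_ *+ m]mulr_natl.
have -> : alm * (mu / bem) + gam * (M * (mu / bem)) = (alm + M * gam) * (mu / bem) by ring.
by rewrite gamE addrC subrK mulrC divfK// gt_eqF// bem_gt0.
Qed.

Lemma gram_rr (i j : 'I_Nt) :
  dotp (col (rshift m i) Phi) (col (rshift m j) Phi) =
  mutm + (1 - mutm) * \sum_k Psi k i * Psi k j.
Proof.
rewrite dotp_colE dot_right; congr (_ + _).
  under eq_bigr do rewrite block_mxEur mxE.
  rewrite sumr_const card_ord -[_ *+ m]mulr_natl mutmE -bem_sqr.
  by field; rewrite gt_eqF// bem_gt0.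
rewrite mulr_sumr mulr_sumr; apply: eq_bigr => k _.
rewrite block_mxEdr mxE -[in RHS](sqr_sqrtr (_ : 0 <= 1 - mutm)); last first.
  by rewrite subr_ge0 ltW// mutm_lt1.
by ring.
Qed.

Lemma block_dictionary : dictionary Psi -> dictionary Phi.
Proof.
move=> dPsi i; rewrite /norm2.
have [k ->|k ->] := split_ordP i.
  by rewrite gram_ll eqxx mulr1 addrK sqrtr1.
rewrite gram_rr -[RHS]sqrtr1; congr Num.sqrt.
have /dictionaryP/(_ k) := dPsi => h.
by under eq_bigr do rewrite -expr2; rewrite h mulr1 addrC subrK.
Qed.

Lemma dotpC n (x y : 'cV[R]_n) : dotp x y = dotp y x.
Proof. by apply: eq_bigr => k _; rewrite mulrC. Qed.

(** Support-outer pairs attain mu. For two outer atoms the inner product is [mutm] plus a number of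
    modulus at most mu - mutm, hence lies in [- mu, mu]. *)
Lemma block_coherence : (0 < Nt)%N -> (1 - mutm) * coherence Psi <= mu - mutm ->
  coherence Phi = mu.
Proof.
move=> Nt0 H; apply/eqP; rewrite eq_le; apply/andP; split; last first.
  have := @coherence_ge _ _ _ Phi (lshift Nt (Ordinal m0)) (rshift m (Ordinal Nt0)).
  by rewrite gram_lr ger0_norm ?(ltW mu0)//; apply; rewrite eq_lrshift.
apply: coherence_le; first exact: ltW.
move=> i j; have [k ->|k ->] := split_ordP i; have [l ->|l ->] := split_ordP j.
- rewrite (inj_eq (@lshift_inj _ _)) gram_ll => /negPf ->.
  by rewrite mulr0 sub0r normrN ger0_norm// ltW.
- by rewrite gram_lr ger0_norm// ltW.
- by rewrite dotpC gram_lr ger0_norm// ltW.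
rewrite (inj_eq (@rshift_inj _ _)) => kl; rewrite gram_rr.
have := coherence_ge Psi kl; rewrite dotp_colE; set c := \sum_k0 _ => hc.
have t1 : 0 <= 1 - mutm by rewrite subr_ge0 ltW// mutm_lt1.
have := le_trans (ler_wpM2l t1 hc) H.
rewrite -{1}(ger0_norm t1) -normrM ler_norml => /andP[h1 h2].
have := mutm_gt0; rewrite ler_norml; move=> ?; apply/andP; split; lra.
Qed.

End block_dictionary.

(** * Signal and noise seen by the atoms *)

Section construction.
Variables (R : realType) (m pt Nt : nat) (mu : R).
Hypothesis m0 : (0 < m)%N.
Local Notation M := (m%:R : R).
Hypothesis mu0 : 0 < mu.
Hypothesis mumax : (2 * M - 1) * mu < 1.
Variable Psi : 'M[R]_(pt, Nt).
Hypothesis dPsi : dictionary Psi.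
Local Notation D := (Dm m mu).
Local Notation rho := (rhom m mu).
Local Notation mut := (mutm m mu).
Local Notation Phi := (block_dict m mu Psi).

Let M0 : 0 < M := M_gt0 R m0.
Let D0 : 0 < D := Dm_gt0 m0 mu0 mumax.

Lemma rhom_sqrtM : rho * Num.sqrt M = bem m mu.
Proof.
rewrite /rhom sqrtrM ?(ltW D0)// sqrtrV; last exact: ltW.
by rewrite divfK// gt_eqF// sqrtr_gt0.
Qed.

Lemma rhom_gt0 : 0 < rho.
Proof. by rewrite sqrtr_gt0 divr_gt0. Qed.

Lemma sqrt_mutm : Num.sqrt mut = mu / rho.
Proof. by rewrite /mutm -exprVn -exprMn sqrtr_sqr ger0_norm// divr_ge0 ?ltW// rhom_gt0. Qed.

(** The squared norm of a support atom minus the mean of all of them. It vanishes for m = 1, where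
    the normalization in [cU] degenerates; hence the separate treatment of that case. *)
Lemma rhom_compl : 1 - rho ^+ 2 = (1 + mu) * (1 - M^-1).
Proof. by rewrite (rhom_sqr m0 mu0 mumax) /Dm; field; rewrite gt_eqF. Qed.

Definition cZ : 'I_(m + pt) -> R :=
  fun k => row_mx (const_mx (Num.sqrt M)^-1 : 'rV_m) (0 : 'rV_pt) ord0 k.

Definition cU (a : 'I_m) : 'I_(m + pt) -> R := fun k =>
  row_mx (\row_i (alm mu / Num.sqrt (1 - rho ^+ 2) * ((i == a)%:R - M^-1)) : 'rV_m)
    (0 : 'rV_pt) ord0 k.

Definition cY (j : 'I_Nt) : 'I_(m + pt) -> R := fun k =>
  row_mx (0 : 'rV_m) (\row_i Psi i j : 'rV_pt) ord0 k.

Lemma sum_cZ (F : 'I_(m + pt) -> R) :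
  \sum_k cZ k * F k = (Num.sqrt M)^-1 * \sum_k F (lshift pt k).
Proof.
rewrite big_split_ord/= [X in _ + X]big1 ?addr0 => [|k _]; last first.
  by rewrite /cZ row_mxEr mxE mul0r.
by rewrite mulr_sumr; apply: eq_bigr => k _; rewrite /cZ row_mxEl mxE.
Qed.

Lemma sum_cU a (F : 'I_(m + pt) -> R) : \sum_k cU a k * F k =
  alm mu / Num.sqrt (1 - rho ^+ 2) * (F (lshift pt a) - M^-1 * \sum_k F (lshift pt k)).
Proof.
rewrite big_split_ord/= [X in _ + X]big1 ?addr0 => [|k _]; last first.
  by rewrite /cU row_mxEr mxE mul0r.
under eq_bigr do rewrite /cU row_mxEl mxE -mulrA mulrBl.
rewrite -mulr_sumr sumrB -mulr_sumr; congr (_ * (_ - _)).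
rewrite (bigD1 a)//= eqxx mul1r big1 ?addr0// => k ki.
by rewrite (negPf ki) mul0r.
Qed.

Lemma sum_cY j (F : 'I_(m + pt) -> R) :
  \sum_k cY j k * F k = \sum_k Psi k j * F (rshift m k).
Proof.
rewrite big_split_ord/= [X in X + _]big1 ?add0r => [|k _]; last first.
  by rewrite /cY row_mxEl mxE mul0r.
by apply: eq_bigr => k _; rewrite /cY row_mxEr mxE.
Qed.

Lemma cZ_unit : \sum_k cZ k ^+ 2 = 1.
Proof.
under eq_bigr do rewrite expr2; rewrite sum_cZ.
under eq_bigr do rewrite /cZ row_mxEl mxE.
rewrite sumr_const card_ord -[_^-1 *+ m]mulr_natl mulrCA -invfM -expr2 sqr_sqrtr ?ltW//.
by rewrite mulfV// gt_eqF.
Qed.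

Lemma cU_unit a : (1 < m)%N -> \sum_k cU a k ^+ 2 = 1.
Proof.
move=> m1; have M1 : 1 < M by rewrite ltr1n.
have k0 : 0 < 1 - rho ^+ 2.
  rewrite rhom_compl mulr_gt0 ?subr_gt0 ?invf_lt1// addr_gt0//.
under eq_bigr do rewrite expr2; rewrite sum_cU.
under [\sum_(_ < m) _]eq_bigr do rewrite /cU row_mxEl mxE.
rewrite -mulr_sumr sumrB sumr_const card_ord.
have -> : \sum_(i < m) (i == a)%:R = 1 :> R.
  by rewrite (bigD1 a)//= eqxx big1 ?addr0// => k ki; rewrite (negPf ki).
rewrite -[_^-1 *+ m]mulr_natl mulfV ?gt_eqF// subrr mulr0 mulr0 subr0.
rewrite /cU row_mxEl mxE eqxx mulrA -expr2 exprMn exprVn.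
rewrite [Num.sqrt (1 - _) ^+ 2]sqr_sqrtr ?(ltW k0)// alm_sqr// rhom_compl.
have i1 : 0 < 1 - M^-1 by rewrite subr_gt0 invf_lt1.
have -> : true%:R - M^-1 = 1 - M^-1 by [].
rewrite invfM mulrA mulfV ?mul1r ?mulVf// gt_eqF//.
exact: addr_gt0.
Qed.

Lemma cY_unit j : \sum_k cY j k ^+ 2 = 1.
Proof.
under eq_bigr do rewrite expr2; rewrite sum_cY.
have /dictionaryP/(_ j) := dPsi => <-; apply: eq_bigr => k _.
by rewrite /cY row_mxEr mxE expr2.
Qed.

Lemma cY_dot j k : \sum_i cY j i * cY k i = \sum_i Psi i j * Psi i k.
Proof. by rewrite sum_cY; apply: eq_bigr => i _; rewrite /cY row_mxEr mxE. Qed.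

(* lin xi cZ, lin xi (cU a) and lin xi (cY j) are the noise along the mean of the
   support atoms, along the centered support atom a, and along the atom j of Psi
   placed orthogonally to the support. *)
Definition spike (X : R) : 'cV[R]_(m + Nt) := col_mx (const_mx X) 0.

Lemma spike_left X i : spike X (lshift Nt i) ord0 = X.
Proof. by rewrite /spike col_mxEu mxE. Qed.

Lemma spike_right X j : spike X (rshift m j) ord0 = 0.
Proof. by rewrite /spike col_mxEd mxE. Qed.

Lemma supp_spike X : X != 0 -> supp (spike X) = [set lshift Nt i | i : 'I_m]%SET.
Proof.
move=> X0; apply/setP => i; rewrite inE; have [k ->|k ->] := split_ordP i.
  by rewrite spike_left X0; apply/esym/imsetP; exists k.
rewrite spike_right eqxx; apply/esym/imsetP => -[l _ /eqP].
by rewrite eq_rlshift.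
Qed.

Lemma spike_sparse X : X != 0 -> sparse m (spike X).
Proof.
move=> X0; rewrite /sparse supp_spike// card_imset ?card_ord//.
exact: lshift_inj.
Qed.

Lemma spike_xmin X : 0 < X -> xmin (spike X) = X.
Proof.
move=> X0; rewrite /xmin [X in inf X](_ : _ = [set X]); first by rewrite inf1.
apply/seteqP; split => [_ [i /= + <-]|_ ->].
  rewrite supp_spike ?gt_eqF// => /imsetP[k _ ->].
  by rewrite spike_left gtr0_norm.
exists (lshift Nt (Ordinal m0)); last by rewrite spike_left gtr0_norm.
by rewrite /= supp_spike ?gt_eqF//; apply/imsetP; exists (Ordinal m0).
Qed.

Section noise.
Variables (d : measure_display) (T : measurableType d) (P : probability T R)
  (xi : 'I_(m + pt) -> {RV P >-> R}).

Let S (w : T) : R := \sum_k xi (lshift pt k) w.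

Lemma lin_cZ w : lin xi cZ w = (Num.sqrt M)^-1 * S w.
Proof. exact: (sum_cZ (fun k => xi k w)). Qed.

Definition noiseV (a : 'I_m) (w : T) : R := alm mu * (xi (lshift pt a) w - M^-1 * S w).

Lemma noiseV_lin a w : (1 < m)%N ->
  noiseV a w = Num.sqrt (1 - rho ^+ 2) * lin xi (cU a) w.
Proof.
move=> m1; have M1 : 1 < M by rewrite ltr1n.
have k0 : 0 < 1 - rho ^+ 2.
  rewrite rhom_compl mulr_gt0 ?subr_gt0 ?invf_lt1// addr_gt0//.
rewrite /lin (sum_cU a (fun k => xi k w)) mulrA mulrCA mulfV ?mulr1//.
by rewrite gt_eqF// sqrtr_gt0.
Qed.

Lemma noiseV1 a w : m = 1%N -> noiseV a w = 0.
Proof.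
rewrite /noiseV /S => m1.
have -> : \sum_k xi (lshift pt k) w = xi (lshift pt a) w.
  rewrite (bigD1 a)//= big1 ?addr0// => k /eqP[]; apply: val_inj.
  have := ltn_ord k; have := ltn_ord a.
  by rewrite [X in (_ < X)%N -> _]m1 [X in _ -> (_ < X)%N -> _]m1 !ltnS !leqn0 => /eqP /= -> /eqP /= ->.
have -> : M = 1 by rewrite m1.
by rewrite invr1 mul1r subrr mulr0.
Qed.

(** Since gam = bem / M - alm / M, the alm terms form the centred part, and the rest is bem / M =
    rho / sqrt M times the sum of the coordinates. *)
Lemma noise_left a w : \sum_k Phi k (lshift Nt a) * xi k w =
  rho * lin xi cZ w + noiseV a w.
Proof.
rewrite (dot_left _ _ _ (fun k => xi k w)) lin_cZ /noiseV -/(S w).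
have -> : rho * ((Num.sqrt M)^-1 * S w) = bem m mu / M * S w.
  rewrite -rhom_sqrtM -[X in _ / X * _](sqr_sqrtr (ltW M0)).
  by field; rewrite gt_eqF// sqrtr_gt0.
by rewrite /gam; field; rewrite gt_eqF.
Qed.

Lemma noise_right j w : \sum_k Phi k (rshift m j) * xi k w =
  Num.sqrt mut * lin xi cZ w + Num.sqrt (1 - mut) * lin xi (cY j) w.
Proof.
rewrite (dot_right _ _ _ (fun k => xi k w)) lin_cZ -/(S w).
rewrite /lin (sum_cY j (fun k => xi k w)); congr (_ + _).
have r0 := rhom_gt0; have sM : 0 < Num.sqrt M by rewrite sqrtr_gt0.
rewrite sqrt_mutm -rhom_sqrtM; field; by rewrite !gt_eqF.
Qed.

Definition obs (X sigma : R) (w : T) : 'cV[R]_(m + pt) :=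
  Phi *m spike X + sigma *: \col_(k < m + pt) xi k w.

Lemma dotp_obs X sigma w i : dotp (col i Phi) (obs X sigma w) =
  X * (\sum_a dotp (col i Phi) (col (lshift Nt a) Phi)) +
  sigma * \sum_k Phi k i * xi k w.
Proof.
transitivity (\sum_k (Phi k i * (\sum_a Phi k (lshift Nt a)) * X +
    sigma * (Phi k i * xi k w))).
  apply: eq_bigr => k _; rewrite [col i Phi k ord0]mxE.
  have -> : obs X sigma w k ord0 = \sum_j Phi k j * spike X j ord0 + sigma * xi k w.
    by rewrite !mxE.
  rewrite mulrDr; congr (_ + _); last by ring.
  rewrite big_split_ord/= [X in _ + X]big1 ?addr0 => [|a _]; last first.
    by rewrite spike_right mulr0.
  rewrite -mulrA; congr (_ * _); rewrite mulr_suml; apply: eq_bigr => a _.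
  by rewrite spike_left.
rewrite big_split/= -mulr_sumr -mulr_suml mulrC; congr (_ * _ + _).
under [LHS]eq_bigr do rewrite mulr_sumr.
rewrite exchange_big/=; apply: eq_bigr => a _; by rewrite dotp_colE.
Qed.

Lemma dotp_obs_left X sigma w a : dotp (col (lshift Nt a) Phi) (obs X sigma w) =
  X * D + sigma * (rho * lin xi cZ w + noiseV a w).
Proof.
rewrite dotp_obs noise_left; congr (_ * _ + _).
under eq_bigr do rewrite gram_ll//.
rewrite sumrB sumr_const card_ord -mulr_sumr (bigD1 a)//= eqxx big1 => [|k ki]; last first.
  by rewrite eq_sym (negPf ki).
by rewrite addr0 mulr1 /Dm -[mu *+ m]mulr_natl; ring.
Qed.

Lemma dotp_obs_right X sigma w j : dotp (col (rshift m j) Phi) (obs X sigma w) =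
  X * (M * mu) +
  sigma * (Num.sqrt mut * lin xi cZ w + Num.sqrt (1 - mut) * lin xi (cY j) w).
Proof.
rewrite dotp_obs noise_right; congr (_ * _ + _).
under eq_bigr do rewrite dotpC gram_lr//.
by rewrite sumr_const card_ord mulr_natl.
Qed.

(** Support correlations are at most X D + sigma (rho z0 + b0), and that of the outer atom j exceeds
    X M mu + sigma (sqrt(1 - mut) u - sqrt(mut) z0). The equation on X makes the two bounds
    equal. *)
Lemma failure (X sigma u z0 b0 : R) w : 0 < X -> 0 < sigma ->
  X * (D - M * mu) = sigma *
    (Num.sqrt (1 - mut) * u - b0 - (rho + Num.sqrt mut) * z0) ->
  `|lin xi cZ w| <= z0 -> (forall a, `|noiseV a w| <= b0) ->
  (exists j, u < lin xi (cY j) w) ->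
  omp_fails Phi (obs X sigma w) m (supp (spike X)).
Proof.
move=> X0 s0 E Zz Vb [j uj].
apply: (@omp_fails_of_first _ _ _ _ _ _ _ (rshift m j)) => // i.
rewrite supp_spike ?gt_eqF// => /imsetP[a _ ->].
rewrite dotp_obs_left dotp_obs_right.
have c0 : 0 < Num.sqrt (1 - mut).
  by rewrite sqrtr_gt0 subr_gt0; exact: (mutm_lt1 m0 mu0 mumax).
have r0 := ltW rhom_gt0.
have t0 : 0 <= Num.sqrt mut by exact: sqrtr_ge0.
set Z := lin xi cZ w in Zz *; set V := noiseV a w.
have Va : `|V| <= b0 by exact: Vb.
apply: le_lt_trans (_ : X * D + sigma * (rho * z0 + b0) < _).
  apply: le_trans (ler_normD _ _) _; rewrite (ger0_norm (mulr_ge0 (ltW X0) (ltW D0))) lerD2l.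
  rewrite normrM gtr0_norm// ler_pM2l//; apply: le_trans (ler_normD _ _) _.
  by apply: lerD => //; rewrite normrM ger0_norm// ler_wpM2l.
apply: lt_le_trans (ler_norm _).
have -> : X * D = X * (M * mu) + X * (D - M * mu) by ring.
rewrite E -addrA ltrD2l -mulrDr ltr_pM2l//.
have h1 : Num.sqrt (1 - mut) * u < Num.sqrt (1 - mut) * lin xi (cY j) w by rewrite ltr_pM2l.
have h2 : - (Num.sqrt mut * z0) <= Num.sqrt mut * Z.
  rewrite -mulrN ler_wpM2l//; by move: Zz; rewrite ler_norml => /andP[].
lra.
Qed.

End noise.

End construction.

(** * Probability of failure *)

Section failure_probability.
Variables (R : realType) (m pt Nt : nat) (mu beta : R).
Hypothesis m0 : (0 < m)%N.
Hypothesis Nt3 : (3 <= Nt)%N.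
Local Notation M := (m%:R : R).
Local Notation N := (m + Nt)%N.
Hypothesis mu0 : 0 < mu.
Hypothesis mumax : (2 * M - 1) * mu < 1.
Hypothesis beta0 : 0 < beta.
Hypothesis mN : M <= N%:R `^ beta.
Variable Psi : 'M[R]_(pt, Nt).
Hypothesis dPsi : dictionary Psi.
Hypothesis cPsi : coherence Psi <= mu.
Local Notation rho := (rhom m mu).
Local Notation mut := (mutm m mu).
Variables (d : measure_display) (T : measurableType d) (P : probability T R)
  (xi : 'I_(m + pt) -> {RV P >-> R}).
Hypothesis hxi : standard_gaussian xi.

Let N3 : (3 <= N)%N.
Proof. by rewrite (leq_trans Nt3)// leq_addl. Qed.
Let lN1 : 1 < ln N%:R :> R := ln_gt1 R N3.
Let lN0 : 0 < ln N%:R :> R := lt_trans ltr01 lN1.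
Let llN0 : 0 < ln (ln N%:R) :> R.
Proof. exact: ln_gt0. Qed.

Definition common_level : R := Num.sqrt (2 * ln (ln N%:R)).
Definition spread_level : R := Num.sqrt (2 * beta * (1 - rho ^+ 2) * ln N%:R).
Definition max_level : R := Num.sqrt (2 * (1 - mu) * ln Nt%:R) - 5 * Num.sqrt (ln (ln Nt%:R)).

Lemma common_tail : fine (P (two_sided xi (@cZ R m pt) common_level)) <=
  (ln N%:R * Num.sqrt (pi * ln (ln N%:R)))^-1.
Proof.
apply: le_trans (two_sided_tail hxi (cZ_unit R pt m0) _) _.
  by rewrite sqrtr_gt0 mulr_gt0.
by rewrite two_phi_sqrt// expRN lnK ?posrE// invfM.
Qed.

(** Empty for m = 1, where the centred noise is identically zero ([noiseV1]). *)
Definition spread (a : 'I_m) : set T :=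
  if (1 < m)%N then two_sided xi (@cU R m pt mu a) (Num.sqrt (2 * (beta * ln N%:R))) else set0.

Lemma spread_measurable a : measurable (spread a).
Proof. by rewrite /spread; case: ifP => _ //; exact: two_sided_measurable. Qed.

Lemma spreadN a w : ~ spread a w -> `|noiseV mu xi a w| <= spread_level.
Proof.
rewrite /spread; case: ifP => [m1|/negbT]; last first.
  rewrite -leqNgt => m1 _; rewrite noiseV1 ?normr0 ?sqrtr_ge0//.
  by apply/eqP; rewrite eqn_leq m1.
move=> /two_sidedN h; rewrite (noiseV_lin m0 mu0 mumax)// normrM.
have -> : spread_level = Num.sqrt (1 - rho ^+ 2) * Num.sqrt (2 * (beta * ln N%:R)).
  rewrite mulrC -sqrtrM; last by rewrite !mulr_ge0 ?ltW.
  by congr Num.sqrt; ring.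
by rewrite (ger0_norm (sqrtr_ge0 _)) ler_wpM2l// sqrtr_ge0.
Qed.

(** The m <= N^beta events of the union bound are compensated by the factor exp(- beta ln N) = N^(-
    beta) of each tail. *)
Lemma spread_tail : fine (P (\big[setU/set0]_(a <- index_enum 'I_m) spread a)) <=
  (Num.sqrt (pi * beta * ln N%:R))^-1.
Proof.
have bl0 : 0 < beta * ln N%:R by rewrite mulr_gt0.
set q := _^-1.
have q0 : 0 <= q by rewrite invr_ge0 sqrtr_ge0.
apply: le_trans (@fineP_bigsetU _ _ _ P _ (index_enum 'I_m) spread (expR (- (beta * ln N%:R)) * q) _ _) _.
- exact: spread_measurable.
- move=> a; rewrite /spread; case: ifP => [m1|_]; last by rewrite measure0 mulr_ge0 ?expR_ge0.
  apply: le_trans (two_sided_tail hxi (cU_unit pt m0 mu0 mumax a m1) _) _.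
    by rewrite sqrtr_gt0 mulr_gt0.
  by rewrite two_phi_sqrt// /q mulrA.
have -> : size (index_enum 'I_m) = m by rewrite -[RHS]card_ord cardE enumT.
rewrite mulrA ler_piMl// expRN ler_pdivrMr ?expR_gt0// mul1r.
by apply: le_trans mN _; rewrite /powR ifF//; apply/negbTE; rewrite pnatr_eq0 -lt0n (leq_trans _ N3).
Qed.

Lemma max_tail :
  let th := Num.sqrt (ln (ln Nt%:R) * Num.min mu^-1 (ln Nt%:R)) : R in
  1 < 100^-1 * th ->
  fine (P [set w | forall j, lin xi (@cY R m pt Nt Psi j) w <= max_level]) <= 6 * expR (- 100^-1 * th).
Proof.
move=> th th1; apply: max_lower_tail_bound => //.
- exact: (mu_lt1 m0 mu0 mumax).
- by move=> j; exact: cY_unit.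
move=> j k jk; rewrite cY_dot -dotp_colE; apply: le_trans (ler_norm _) _.
exact: le_trans (coherence_ge Psi jk) cPsi.
Qed.

Lemma failure_prob (X sigma : R) :
  let th := Num.sqrt (ln (ln Nt%:R) * Num.min mu^-1 (ln Nt%:R)) : R in
  0 < X -> 0 < sigma ->
  X * (Dm m mu - M * mu) = sigma *
    (Num.sqrt (1 - mut) * max_level - spread_level - (rho + Num.sqrt mut) * common_level) ->
  with_prob_ge P (1 - 6 * expR (- 100^-1 * th)
      - (ln N%:R * Num.sqrt (pi * ln (ln N%:R)))^-1
      - (Num.sqrt (pi * beta * ln N%:R))^-1)
    [set w | omp_fails (block_dict m mu Psi) (obs mu Psi xi X sigma w) m
       (supp (spike m Nt X))].
Proof.
move=> th X0 s0 E.
set t2 := (_ * _)^-1; set t3 := (Num.sqrt _)^-1.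
have t20 : 0 <= t2 by rewrite invr_ge0 mulr_ge0 ?sqrtr_ge0 ?ltW.
have t30 : 0 <= t3 by rewrite invr_ge0 sqrtr_ge0.
have [th1|th1] := leP (100^-1 * th) 1.
  (* The claimed probability is then nonpositive. *)
  exists set0; split => //; rewrite measure0 lee_fin.
  have : 1 <= 3 * expR (- 100^-1 * th).
    have e3 := ltW (expR1_lt3 R).
    apply: le_trans (_ : expR 1 * expR (- 100^-1 * th) <= _).
      by rewrite -expRD -[leLHS]expR0 ler_expR; lra.
    by rewrite ler_wpM2r ?expR_ge0.
  have := expR_ge0 (- 100^-1 * th); lra.
pose B1 : set T := [set w | forall j, lin xi (@cY R m pt Nt Psi j) w <= max_level].
pose B2 : set T := two_sided xi (@cZ R m pt) common_level.
pose B3 : set T := \big[setU/set0]_(a <- index_enum 'I_m) spread a.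
have mB1 : measurable B1.
  rewrite (_ : B1 = \bigcap_(j in [set: 'I_Nt]) [set w | lin xi (@cY R m pt Nt Psi j) w <= max_level]).
    by apply: fin_bigcap_measurable => [|j _]; [exact: finite_finset|exact: lin_le_measurable].
  by apply/seteqP; split => [w h j _|w h j]; [exact: h|exact: (h j I)].
have mB2 : measurable B2 by exact: two_sided_measurable.
have mB3 : measurable B3 by apply: bigsetU_measurable => a _; exact: spread_measurable.
have mB : measurable (B1 `|` B2 `|` B3) by apply: measurableU => //; exact: measurableU.
exists (~` (B1 `|` B2 `|` B3)); split.
- exact: measurableC.
- move=> w wB; apply: (@failure _ _ _ _ _ m0 mu0 mumax _ _ _ _ _ _ _ max_level common_level spread_level) => //.
  + by apply: two_sidedN => h; apply: wB; left; right.
  + move=> a; apply: spreadN => h; apply: wB; right.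
    by rewrite /B3 -bigcup_seq; exists a; rewrite //= mem_index_enum.
  + apply: contrapT => h; apply: wB; left; left => j.
    by rewrite leNgt; apply/negP => uj; apply: h; exists j.
have H1 := max_tail th1; have H2 := common_tail; have H3 := spread_tail.
have H12 := fineP_setU P mB1 mB2.
have H123 := fineP_setU P (measurableU _ _ mB1 mB2) mB3.
rewrite -/B1 -/th in H1; rewrite -/B2 -/t2 in H2; rewrite -/B3 -/t3 in H3.
rewrite probability_setC// -[P _]fineK ?fin_num_measure// -EFinB lee_fin.
lra.
Qed.

End failure_probability.

(* With mut as in theorem3, the last conclusion is L <= (mu - mut) / (1 - mut). *)
Lemma quadratic_condition (R : realType) (M mu L : R) :
  let disc := 1 - 4 * L * (2 * M - 1 - L * M) / (1 + L * (M - 1)) ^+ 2 in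
  1 <= M -> 0 <= L -> L <= 1 -> 2 * M - 1 - L * M != 0 ->
  M <= (3 - L - Num.sqrt (8 - 8 * L)) / L ->
  (1 + L * (M - 1)) * (1 - Num.sqrt disc) / (2 * (2 * M - 1 - L * M)) <= mu ->
  mu <= (1 + L * (M - 1)) * (1 + Num.sqrt disc) / (2 * (2 * M - 1 - L * M)) ->
  0 < mu /\ L * (1 - (M - 1) * mu - M * mu ^+ 2) <= mu - (2 * M - 1) * mu ^+ 2.
Proof.
move=> disc M1 L0 L1 nz ML lo up.
(* For L = 0 the quotient bounding M is 0 by convention, against M >= 1. *)
have L_gt0 : 0 < L.
  rewrite lt_def L0 andbT; apply/eqP => Lz.
  by move: ML; rewrite Lz invr0 mulr0; lra.
have A0 : 0 < 2 * M - 1 - L * M by rewrite lt_def nz /=; nra.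
have B0 : 0 < 1 + L * (M - 1) by nra.
rewrite ler_pdivlMr// in ML.
have s0 : 0 <= 8 - 8 * L by lra.
have discE : disc * (1 + L * (M - 1)) ^+ 2 =
    (1 + L * (M - 1)) ^+ 2 - 4 * L * (2 * M - 1 - L * M).
  by rewrite /disc; field; rewrite gt_eqF.
have dlt : disc < 1.
  by rewrite /disc ltrBlDr ltrDl divr_gt0 ?exprn_gt0// !mulr_gt0.
clearbody disc.
set A := 2 * M - 1 - L * M in nz lo up A0 discE.
set B := 1 + L * (M - 1) in lo up B0 discE.
(* B^2 - 4 L A equals (L M)^2 - 2 (3 - L) L M + (1 + L)^2, a quadratic in L M with roots 3 - L -
   sqrt(8 - 8L) and 3 - L + sqrt(8 - 8L); the bound on M puts L M below the smaller one. *)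
have disc0 : 0 <= disc.
  rewrite -(pmulr_lge0 _ (exprn_gt0 2 B0)) discE.
  have := sqrtr_ge0 (8 - 8 * L); have := sqr_sqrtr s0.
  by set r := Num.sqrt _ in ML *; rewrite /A /B; nra.
set q := Num.sqrt disc in lo up.
have q0 : 0 <= q by exact: sqrtr_ge0.
have q2 : q ^+ 2 = disc by exact: sqr_sqrtr.
have A20 : 0 < 2 * A by rewrite mulr_gt0.
rewrite ler_pdivrMr// in lo; rewrite ler_pdivlMr// in up.
have q1 : q < 1 by rewrite -(ltr_pXn2r (_ : 0 < 2)%N) ?nnegrE// q2 expr1n.
split.
  rewrite -(pmulr_lgt0 _ A20); apply: lt_le_trans lo.
  by rewrite mulr_gt0// subr_gt0.
(* The bounds on mu say that it lies between the roots of A mu^2 - B mu + L; the sign of this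
   quadratic there is the conclusion, rearranged. *)
have key : (2 * A * mu - B) ^+ 2 <= B ^+ 2 - 4 * L * A.
  rewrite -discE -q2 -exprMn -ler_sqrt ?sqr_ge0// !sqrtr_sqr.
  rewrite (ger0_norm (mulr_ge0 q0 (ltW B0))) ler_norml; apply/andP; split; lra.
have : A * (A * mu ^+ 2 - B * mu + L) <= 0 by nra.
rewrite pmulr_rle0// /A /B; lra.
Qed.

Theorem theorem3 (R : realType) :
  exists c0 C : R, [/\ 0 < c0, 0 < C &
  forall (p N m : nat) (sigma mu beta : R),
  let pt := (p - m)%N in
  let Nt := (N - m)%N in
  let L : R := mu_min R pt Nt in
  let disc := 1 - 4 * L * (2 * m%:R - 1 - L * m%:R)
                  / (1 + L * (m%:R - 1)) ^+ 2 in
  let rho := Num.sqrt ((1 - (m%:R - 1) * mu) / m%:R) in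
  let mut := mu ^+ 2 / rho ^+ 2 in
  let Rgap := Num.sqrt (2 * (1 - mu) * (1 - mut) * ln Nt%:R)
              - Num.sqrt (2 * beta * (1 - rho ^+ 2) * ln N%:R)
              - c0 * Num.sqrt ((1 - mut) * ln (ln Nt%:R))
              - (rho + Num.sqrt mut) * Num.sqrt (2 * ln (ln N%:R)) in
  let P0 := 1 - 6 * expR (- C * Num.sqrt (ln (ln Nt%:R)
                                          * Num.min mu^-1 (ln Nt%:R)))
            - (ln N%:R * Num.sqrt (pi * ln (ln N%:R)))^-1
            - (Num.sqrt (pi * beta * ln N%:R))^-1 in
  (0 < p)%N -> (p < N)%N -> 0 < sigma -> (1 <= m)%N ->
  (1 <= p - m)%N -> (3 <= N - m)%N -> 2 * m%:R - 1 - L * m%:R != 0 ->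
  mu < (2 * m%:R - 1)^-1 ->
  0 < beta -> beta < 1 ->
  m%:R <= Num.min (N%:R `^ beta) p%:R ->
  m%:R <= (3 - L - Num.sqrt (8 - 8 * L)) / L ->
  (1 + L * (m%:R - 1)) * (1 - Num.sqrt disc)
    / (2 * (2 * m%:R - 1 - L * m%:R)) <= mu ->
  mu <= (1 + L * (m%:R - 1)) * (1 + Num.sqrt disc)
    / (2 * (2 * m%:R - 1 - L * m%:R)) ->
  0 < Rgap ->
  exists (Phi : 'M[R]_(p, N)) (x : 'cV[R]_N),
    [/\ dictionary Phi, coherence Phi = mu, sparse m x,
        xmin x = sigma / (1 - (2 * m%:R - 1) * mu) * Rgap &
        forall (d : measure_display) (T : measurableType d)
               (P : probability T R) (xi : 'I_p -> {RV P >-> R}),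
          standard_gaussian xi ->
          with_prob_ge P P0
            [set w | omp_fails Phi
                       (Phi *m x + sigma *: \col_(k < p) xi k w) m (supp x)]]].
Proof.
exists 5, 100^-1; split => // p N m sigma mu beta.
move=> pt Nt L disc rho mut Rgap P0 _ pN s0 m1 pt1 Nt3 nz mulim beta0 _ mN mL lo up R0.
have [pt' pE] : exists pt', p = (m + pt')%N.
  by exists (p - m)%N; rewrite subnKC// ltnW// -subn_gt0.
have [Nt' NE] : exists Nt', N = (m + Nt')%N.
  by exists (N - m)%N; rewrite subnKC// ltnW// -subn_gt0 (leq_trans _ Nt3).
subst p N; rewrite addKn in pt1; rewrite addKn in Nt3.
have ptE : pt = pt' by rewrite /pt addKn.
have NtE : Nt = Nt' by rewrite /Nt addKn.
clearbody pt Nt; subst pt Nt.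
have M1 : 1 <= m%:R :> R by rewrite ler1n.
have [Psi dPsi cPsi] := mu_min_attained R Nt' pt1.
have L0 : 0 <= L by rewrite /L -cPsi coherence_ge0.
have L1 : L <= 1 by rewrite /L -cPsi coherence_le1.
have [mu0 quad] := quadratic_condition M1 L0 L1 nz mL lo up.
have mumax : (2 * m%:R - 1) * mu < 1.
  by move: mulim; rewrite -[_^-1]mul1r ltr_pdivlMr 1?mulrC//; lra.
have D0 := Dm_gt0 m1 mu0 mumax; have t1 := mutm_lt1 m1 mu0 mumax.
have mutE : mut = mutm m mu by [].
have cond : (1 - mutm m mu) * coherence Psi <= mu - mutm m mu.
  rewrite cPsi -(ler_pM2l D0) (mutmE m1 mu0 mumax).
  have -> : Dm m mu * ((1 - mu ^+ 2 * m%:R / Dm m mu) * mu_min R pt' Nt') =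
    mu_min R pt' Nt' * (Dm m mu - m%:R * mu ^+ 2) by field; rewrite gt_eqF.
  have -> : Dm m mu * (mu - mu ^+ 2 * m%:R / Dm m mu) = mu * Dm m mu - m%:R * mu ^+ 2.
    by field; rewrite gt_eqF.
  by move: quad; rewrite /Dm -/L; lra.
(* By mu <= 1, mu - mut <= mu (1 - mut), and [cond] is divided by 1 - mut > 0. *)
have cmu : coherence Psi <= mu.
  have := mutm_gt0 m1 mu0 mumax; have := mu_lt1 m1 mu0 mumax; move: cond t1.
  set t := mutm m mu; set c := coherence Psi; nra.
have X0 : 0 < sigma / (1 - (2 * m%:R - 1) * mu) * Rgap.
  by rewrite mulr_gt0// divr_gt0// subr_gt0.
set X := sigma / _ * _ in X0 *.
exists (block_dict m mu Psi), (spike m Nt' X); split.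
- exact: block_dictionary.
- by apply: block_coherence => //; exact: leq_trans Nt3.
- by apply: spike_sparse; rewrite gt_eqF.
- exact: spike_xmin.
move=> d T P xi hxi.
apply: (@failure_prob R m pt' Nt' mu beta m1 Nt3 mu0 mumax beta0 _ Psi dPsi cmu d T P xi hxi X sigma X0 s0).
  by move: mN; rewrite le_min => /andP[].
have -> : X * (Dm m mu - m%:R * mu) = sigma * Rgap.
  rewrite /X /Dm; field; rewrite gt_eqF//; lra.
congr (_ * _); rewrite /Rgap; congr (_ - _).
have Eb : spread_level m Nt' mu beta = Num.sqrt (2 * beta * (1 - rho ^+ 2) * ln (m + Nt')%:R) by [].
have c0 : 0 <= 1 - mut by rewrite subr_ge0 ltW.
have E1 : Num.sqrt (2 * (1 - mu) * (1 - mut) * ln Nt'%:R) =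
    Num.sqrt (1 - mut) * Num.sqrt (2 * (1 - mu) * ln Nt'%:R).
  by rewrite -sqrtrM//; congr Num.sqrt; ring.
by rewrite Eb E1 (sqrtrM _ c0) /max_level mutE; ring.
Qed.
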